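(* Let $S=\langle K,\overline{K},\Gamma\cup\{\infty\},v,\mathrm{ac}\rangle$ be a structure of $\mathcal{L}_{RRP}$ such that $K$ has characteristic $0$, $\overline{K}$ has characteristic $0$, $v$ and $\mathrm{ac}$ are interpreted as a valuation map on $K$ with value group $\Gamma$ and residue field $\overline{K}$ and an angular component map respectively, $\Gamma$ is a $\mathbb{Z}$-group, and $\mathrm{Th}(S)$ admits quantifier elimination in the $K$-sort. Then the valuation $v$ is henselian.
   Context: $\mathcal{L}_{RRP}$ is a three-sorted language with sorts $K$ (the main, field sort), $\overline{K}$ (residue field sort) and $\Gamma$ (value group sort); the $K$-sort and $\overline{K}$-sort each carry the ring language $\{+,-,\cdot,0,1\}$, the $\Gamma$-sort carries $\{+,<,0,1\}\cup\{D_n:n>1\}\cup\{\infty\}$ (Presburger language with a top element $\infty$; $D_n$ is divisibility by $n$), and there are function symbols $v:K\to\Gamma\cup\{\infty\}$ and $\mathrm{ac}:K\to\overline{K}$. A $\mathbb{Z}$-group is an ordered abelian group elementarily equivalent to $(\mathbb{Z},+,<,0,1,D_n)_{n>1}$ (with $1$ the least positive element). An angular component map is a map $\mathrm{ac}:K\to\overline{K}$ with $\mathrm{ac}\,0=0$, whose restriction to $K^\times$ is a group homomorphism $K^\times\to\overline{K}^\times$, and with $\mathrm{ac}\,u=u+\mathcal{M}$ for every unit $u$ of the valuation ring. $\mathrm{Th}(S)$ admits quantifier elimination in the $K$-sort if every $\mathcal{L}_{RRP}$-formula is equivalent modulo $\mathrm{Th}(S)$ to one without quantifiers over $K$-sort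 variables. *)

(* Defs.v *)
From HB Require Import structures.
From mathcomp Require Import all_boot all_order all_algebra.

Set Implicit Arguments.
Unset Strict Implicit.
Unset Printing Implicit Defensive.

Import Order.TTheory GRing.Theory Num.Theory.
Local Open Scope ring_scope.

(* Syntax is well-scoped: a formula with n free variables has de Bruijn
   variables in 'I_n, an assignment is an n-tuple, and a quantifier binds the
   variable [ord0], so that binding a value pushes it in front of the tuple.
   Formulas of [_ 0] are the sentences. *)

Inductive pres_term (n : nat) : Type :=
| PVar of 'I_n
| PZero
| POne
| PAdd of pres_term n & pres_term n.

Inductive pres_formula (n : nat) : Type :=
| PEq of pres_term n & pres_term n
| PLt of pres_term n & pres_term n
| PDvd (m : nat) of (1 < m)%N & pres_term n
| PNot of pres_formula n
| PAnd of pres_formula n & pres_formula n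
| POr of pres_formula n & pres_formula n
| PImp of pres_formula n & pres_formula n
| PEx of pres_formula n.+1
| PAll of pres_formula n.+1.

Record pres_structure : Type := PresStructure {
  pcarrier :> Type;
  padd : pcarrier -> pcarrier -> pcarrier;
  plt : pcarrier -> pcarrier -> Prop;
  pzero : pcarrier;
  pone : pcarrier;
  pdvd : nat -> pcarrier -> Prop }.

Fixpoint pres_eval (M : pres_structure) n (e : n.-tuple M)
    (t : pres_term n) : M :=
  match t with
  | PVar i => tnth e i
  | PZero => pzero M
  | POne => pone M
  | PAdd t1 t2 => padd (pres_eval e t1) (pres_eval e t2)
  end.

Fixpoint pres_sat (M : pres_structure) n (e : n.-tuple M)
    (f : pres_formula n) {struct f} : Prop :=
  match f in pres_formula _ with
  | PEq t1 t2 => pres_eval e t1 = pres_eval e t2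
  | PLt t1 t2 => plt (pres_eval e t1) (pres_eval e t2)
  | PDvd m _ t => pdvd m (pres_eval e t)
  | PNot f1 => ~ pres_sat e f1
  | PAnd f1 f2 => pres_sat e f1 /\ pres_sat e f2
  | POr f1 f2 => pres_sat e f1 \/ pres_sat e f2
  | PImp f1 f2 => pres_sat e f1 -> pres_sat e f2
  | PEx f1 => exists x : M, pres_sat [tuple of x :: e] f1
  | PAll f1 => forall x : M, pres_sat [tuple of x :: e] f1
  end.

Definition pres_elementarily_equivalent (M N : pres_structure) : Prop :=
  forall f : pres_formula 0, pres_sat ([tuple] : 0.-tuple M) f <->
                             pres_sat ([tuple] : 0.-tuple N) f.

(* [porderZmodType] relates the order and the addition in no way. *)
Definition ordered_abelian_group (G : porderZmodType) : Prop :=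
  (forall x y : G, (x <= y) || (y <= x)) /\
  (forall x y z : G, x <= y -> x + z <= y + z).

Definition pres_of (G : porderZmodType) (one : G) : pres_structure :=
  {| pcarrier := G;
     padd := fun x y => x + y;
     plt := fun x y => x < y;
     pzero := 0;
     pone := one;
     pdvd := fun m x => exists y : G, x = y *+ m |}.

Definition Zgroup (G : porderZmodType) (one : G) : Prop :=
  [/\ ordered_abelian_group G,
      0 < one /\ (forall x : G, 0 < x -> one <= x)
    & pres_elementarily_equivalent (pres_of one) (pres_of (1 : int))].

(* In [formula a b c], [a], [b], [c] are the numbers of free variables of the
   field sort (K), of the residue field sort (R) and of the value group
   sort (G). *)

Inductive kterm (a : nat) : Type :=
| KVar of 'I_a
| KZero
| KOne
| KAdd of kterm a & kterm a
| KSub of kterm a & kterm a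
| KMul of kterm a & kterm a.

Inductive rterm (a b : nat) : Type :=
| RVar of 'I_b
| RZero
| ROne
| RAdd of rterm a b & rterm a b
| RSub of rterm a b & rterm a b
| RMul of rterm a b & rterm a b
| RAc of kterm a.

Inductive gterm (a c : nat) : Type :=
| GVar of 'I_c
| GZero
| GOne
| GInfty
| GAdd of gterm a c & gterm a c
| GVal of kterm a.

Inductive formula (a b c : nat) : Type :=
| KEq of kterm a & kterm a
| REq of rterm a b & rterm a b
| GEq of gterm a c & gterm a c
| GLt of gterm a c & gterm a c
| GDvd (m : nat) of (1 < m)%N & gterm a c
| FNot of formula a b c
| FAnd of formula a b c & formula a b c
| FOr of formula a b c & formula a b c
| FImp of formula a b c & formula a b c
| KEx of formula a.+1 b c
| KAll of formula a.+1 b c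
| REx of formula a b.+1 c
| RAll of formula a b.+1 c
| GEx of formula a b c.+1
| GAll of formula a b c.+1.

Fixpoint Kquantifier_free a b c (f : formula a b c) : bool :=
  match f with
  | KEq _ _ | REq _ _ | GEq _ _ | GLt _ _ | GDvd _ _ _ => true
  | FNot f1 => Kquantifier_free f1
  | FAnd f1 f2 | FOr f1 f2 | FImp f1 f2 =>
      Kquantifier_free f1 && Kquantifier_free f2
  | KEx _ | KAll _ => false
  | REx f1 | RAll f1 => Kquantifier_free f1
  | GEx f1 | GAll f1 => Kquantifier_free f1
  end.

Record rrp_structure : Type := RRPStructure {
  Ksort : Type;
  Rsort : Type;
  Gsort : Type;
  kadd : Ksort -> Ksort -> Ksort;
  ksub : Ksort -> Ksort -> Ksort;
  kmul : Ksort -> Ksort -> Ksort;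
  kzero : Ksort;
  kone : Ksort;
  radd : Rsort -> Rsort -> Rsort;
  rsub : Rsort -> Rsort -> Rsort;
  rmul : Rsort -> Rsort -> Rsort;
  rzero : Rsort;
  rone : Rsort;
  gadd : Gsort -> Gsort -> Gsort;
  glt : Gsort -> Gsort -> Prop;
  gzero : Gsort;
  gone : Gsort;
  ginfty : Gsort;
  gdvd : nat -> Gsort -> Prop;
  kval : Ksort -> Gsort;
  kac : Ksort -> Rsort }.

Section Semantics.
Variable M : rrp_structure.

Fixpoint keval a (ek : a.-tuple (Ksort M)) (t : kterm a) : Ksort M :=
  match t with
  | KVar i => tnth ek i
  | KZero => kzero M
  | KOne => kone M
  | KAdd t1 t2 => kadd (keval ek t1) (keval ek t2)
  | KSub t1 t2 => ksub (keval ek t1) (keval ek t2)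
  | KMul t1 t2 => kmul (keval ek t1) (keval ek t2)
  end.

Fixpoint reval a b (ek : a.-tuple (Ksort M)) (er : b.-tuple (Rsort M))
    (t : rterm a b) : Rsort M :=
  match t with
  | RVar i => tnth er i
  | RZero => rzero M
  | ROne => rone M
  | RAdd t1 t2 => radd (reval ek er t1) (reval ek er t2)
  | RSub t1 t2 => rsub (reval ek er t1) (reval ek er t2)
  | RMul t1 t2 => rmul (reval ek er t1) (reval ek er t2)
  | RAc t1 => kac (keval ek t1)
  end.

Fixpoint geval a c (ek : a.-tuple (Ksort M)) (eg : c.-tuple (Gsort M))
    (t : gterm a c) : Gsort M :=
  match t with
  | GVar i => tnth eg i
  | GZero => gzero M
  | GOne => gone M
  | GInfty => ginfty M
  | GAdd t1 t2 => gadd (geval ek eg t1) (geval ek eg t2)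
  | GVal t1 => kval (keval ek t1)
  end.

Fixpoint sat a b c (ek : a.-tuple (Ksort M)) (er : b.-tuple (Rsort M))
    (eg : c.-tuple (Gsort M)) (f : formula a b c) {struct f} : Prop :=
  match f in formula _ _ _ with
  | KEq t1 t2 => keval ek t1 = keval ek t2
  | REq t1 t2 => reval ek er t1 = reval ek er t2
  | GEq t1 t2 => geval ek eg t1 = geval ek eg t2
  | GLt t1 t2 => glt (geval ek eg t1) (geval ek eg t2)
  | GDvd m _ t => gdvd m (geval ek eg t)
  | FNot f1 => ~ sat ek er eg f1
  | FAnd f1 f2 => sat ek er eg f1 /\ sat ek er eg f2
  | FOr f1 f2 => sat ek er eg f1 \/ sat ek er eg f2
  | FImp f1 f2 => sat ek er eg f1 -> sat ek er eg f2
  | KEx f1 => exists x : Ksort M, sat [tuple of x :: ek] er eg f1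
  | KAll f1 => forall x : Ksort M, sat [tuple of x :: ek] er eg f1
  | REx f1 => exists x : Rsort M, sat ek [tuple of x :: er] eg f1
  | RAll f1 => forall x : Rsort M, sat ek [tuple of x :: er] eg f1
  | GEx f1 => exists x : Gsort M, sat ek er [tuple of x :: eg] f1
  | GAll f1 => forall x : Gsort M, sat ek er [tuple of x :: eg] f1
  end.

End Semantics.

Definition sentence : Type := formula 0 0 0.

Definition theory : Type := sentence -> Prop.

Definition holds (M : rrp_structure) (f : sentence) : Prop :=
  sat ([tuple] : 0.-tuple (Ksort M)) ([tuple] : 0.-tuple (Rsort M))
      ([tuple] : 0.-tuple (Gsort M)) f.

Definition Th (S : rrp_structure) : theory := holds S.

Definition models (M : rrp_structure) (T : theory) : Prop :=
  forall f : sentence, T f -> holds M f.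

Definition equivalent_modulo (T : theory) a b c (f g : formula a b c) : Prop :=
  forall M : rrp_structure, models M T ->
  forall (ek : a.-tuple (Ksort M)) (er : b.-tuple (Rsort M))
         (eg : c.-tuple (Gsort M)),
  sat ek er eg f <-> sat ek er eg g.

Definition admits_Kquantifier_elimination (T : theory) : Prop :=
  forall a b c (f : formula a b c),
  exists2 g : formula a b c, Kquantifier_free g & equivalent_modulo T f g.

(* The sort G u {oo} is [option G], with [None] for oo. *)
Section Infinity.
Variable G : porderZmodType.
Implicit Types x y : option G.

Definition add_oo x y : option G :=
  match x, y with
  | Some g, Some h => Some (g + h)
  | _, _ => None
  end.

Definition lt_oo x y : bool :=
  match x, y with
  | Some g, Some h => g < h
  | Some _, None => true
  | None, _ => false
  end.

Definition le_oo x y : bool := (x == y) || lt_oo x y.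

Definition min_oo x y : option G := if le_oo x y then x else y.

(* oo is divisible by every m, since m oo = oo. *)
Definition dvd_oo (m : nat) x : Prop :=
  match x with
  | Some g => exists h : G, g = h *+ m
  | None => True
  end.

End Infinity.

Section ValuedFields.
Variables (K k : fieldType) (G : porderZmodType) (v : K -> option G).

Record is_valuation : Prop := IsValuation {
  valuation_eq_oo : forall x, v x = None <-> x = 0;
  valuationM : forall x y, v (x * y) = add_oo (v x) (v y);
  valuationD : forall x y, le_oo (min_oo (v x) (v y)) (v (x + y));
  valuation_surj : forall g : G, exists x, v x = Some g }.

Definition valuation_ring : {pred K} := [pred x | le_oo (Some 0) (v x)].

(* [res] exhibits k as the quotient of the valuation ring by its maximal
   ideal, res x being the class x + M; the values of [res] outside the
   valuation ring are irrelevant. *)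
Record is_residue_map (res : K -> k) : Prop := IsResidueMap {
  residue1 : res 1 = 1;
  residueD : {in valuation_ring &, forall x y, res (x + y) = res x + res y};
  residueM : {in valuation_ring &, forall x y, res (x * y) = res x * res y};
  residue_ker :
    {in valuation_ring, forall x, res x = 0 <-> lt_oo (Some 0) (v x)};
  residue_surj : forall y : k, exists2 x, x \in valuation_ring & res x = y }.

Record is_angular_component (res ac : K -> k) : Prop := IsAngularComponent {
  ac0 : ac 0 = 0;
  ac_neq0 : forall x, x != 0 -> ac x != 0;
  acM : forall x y, x != 0 -> y != 0 -> ac (x * y) = ac x * ac y;
  ac_unit : forall u, v u = Some 0 -> ac u = res u }.

Definition henselian : Prop :=
  forall (p : {poly K}) (x : K),
    p \is a polyOver valuation_ring -> x \in valuation_ring ->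
    lt_oo (Some 0) (v p.[x]) -> v p^`().[x] = Some 0 ->
  exists y, [/\ y \in valuation_ring, root p y & lt_oo (Some 0) (v (y - x))].

Definition rrp_structure_of (one : G) (ac : K -> k) : rrp_structure :=
  {| Ksort := K;
     Rsort := k;
     Gsort := option G;
     kadd := fun x y => x + y;
     ksub := fun x y => x - y;
     kmul := fun x y => x * y;
     kzero := 0;
     kone := 1;
     radd := fun x y => x + y;
     rsub := fun x y => x - y;
     rmul := fun x y => x * y;
     rzero := 0;
     rone := 1;
     gadd := @add_oo G;
     glt := fun x y => lt_oo x y;
     gzero := Some 0;
     gone := Some one;
     ginfty := None;
     gdvd := @dvd_oo G;
     kval := v;
     kac := ac |}.

End ValuedFields.

(* Main.v *)
(* Suppose an integral polynomial p violates Hensel's lemma near x.  The values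
   of p on the open unit ball around x have no largest element, by Newton's
   iteration.  After K-quantifier elimination, the set of values below them is
   definable in the Z-group alone, where a bounded nonempty definable set has a
   maximum; so p takes arbitrarily small values near x, and so does some
   irreducible factor g of p, of degree n > 1.
   Let chi_u be the characteristic polynomial of an element u of K[X]/(g).  If u
   is not a scalar, then chi_u has no root in K, but an arbitrarily small change
   of its constant term gives it one.  By quantifier elimination, having a root
   in K is a locally constant property of the coefficients of a monic polynomial
   of degree n, away from the zero set of finitely many nonzero polynomials.
   This is a contradiction, because the polynomials chi_u are Zariski dense: a
   monic polynomial of degree n over K is the characteristic polynomial of some
   element of F[X]/(g), obtained by interpolation, as soon as the extension F of
   K splits both it and g. *)

Require Import Defs.
From Stdlib Require List.
From Stdlib Require Import Classical.
From mathcomp Require Import all_boot all_order all_algebra all_field.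
From mathcomp Require Import zify ring.

Set Implicit Arguments.
Unset Strict Implicit.
Unset Printing Implicit Defensive.

Import Order.TTheory GRing.Theory Num.Theory.
Local Open Scope ring_scope.

(** * Splitting fields and characteristic polynomials *)

Lemma irreducible_or_factors (K : fieldType) (p : {poly K}) :
  (1 < size p)%N -> irreducible_poly p \/
    exists q r, [/\ p = q * r, (1 < size q < size p)%N & (1 < size r < size p)%N].
Proof.
move=> p_gt1; case: (classic (irreducible_poly p)) => [|red_p]; [by left | right].
have [q [q_neq1 q_dvd nqp]] : exists q : {poly K}, [/\ size q != 1, q %| p & ~~ (q %= p)].
  apply: NNPP => no_q; apply: red_p; split=> // q q1 qp.
  by apply: contraT => nqp; case: no_q; exists q.
have p0 : p != 0 by rewrite -size_poly_gt0 ltnW.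
have [r Dp] := dvdpP _ _ q_dvd.
have [r0 q0] : r != 0 /\ q != 0.
  by split; apply: contra_neq p0 => f0; rewrite Dp f0 ?mul0r ?mulr0.
have q_gt1 : (1 < size q)%N by rewrite ltn_neqAle eq_sym q_neq1 size_poly_gt0.
have lt_qp : (size q < size p)%N.
  rewrite ltn_neqAle dvdp_leq // andbT; apply: contra nqp => /eqP eqs.
  by rewrite -(dvdp_size_eqp q_dvd) eqs.
have size_p : size p = (size r + size q).-1 by rewrite Dp size_mul.
exists r, q; split=> //; last by rewrite q_gt1.
by move: lt_qp q_gt1; rewrite size_p; lia.
Qed.

Lemma irreducible_divisor (K : fieldType) (p : {poly K}) :
  (1 < size p)%N -> exists2 q, irreducible_poly q & q %| p.
Proof.
have [n] := ubnP (size p); elim: n p => // n IHn p; rewrite ltnS => le_p p_gt1.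
have [irr_p|[q [r [Dp /andP[q_gt1 lt_q] _]]]] := irreducible_or_factors p_gt1.
  by exists p.
have [||s irr_s s_dvd] := IHn q; [exact: leq_trans le_p | by [] |].
by exists s => //; rewrite Dp dvdp_mulr.
Qed.

(** Each step adjoins one root of an irreducible factor, so the induction on the degree has to vary
    the base field. *)
Lemma splitting_extension (K : fieldType) (p : {poly K}) : p != 0 ->
  exists (F : fieldType) (f : {rmorphism K -> F}) (rs : seq F),
    map_poly f p %= \prod_(r <- rs) ('X - r%:P).
Proof.
have [n] := ubnP (size p); elim: n K p => // n IHn K p.
rewrite ltnS => le_p p0; case: (leqP (size p) 1) => [p_le1|p_gt1].
  exists K, idfun, [::]; rewrite big_nil map_poly_id // -size_poly_eq1.
  by rewrite eqn_leq p_le1 size_poly_gt0.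
have [q irr_q q_dvd] := irreducible_divisor p_gt1.
have [L _ [z z_root _]] := irredp_FAdjoin irr_q.
have z_rootp : root (map_poly (in_alg L) p) z.
  by case/dvdpP: q_dvd => r ->; rewrite rmorphM rootM z_root orbT.
have /factor_theorem[p' Dp] := z_rootp.
have Lp0 : map_poly (in_alg L) p != 0 by rewrite map_poly_eq0.
have p'0 : p' != 0 by apply: contraNneq Lp0 => p'0; rewrite Dp p'0 mul0r.
have [|F [f [rs Drs]]] := IHn _ p' _ p'0.
  have := size_map_poly (in_alg L) p; rewrite Dp size_Mmonic ?monicXsubC //.
  by rewrite size_XsubC addn2 /= => eqs; rewrite eqs.
exists F, (f \o in_alg L), (f z :: rs).
rewrite map_poly_comp Dp rmorphM /= map_polyXsubC big_cons mulrC.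
by rewrite eqp_mull.
Qed.

(** * Terms in the coefficients of a characteristic polynomial *)

Fixpoint kterm_eval (R : pzRingType) a (e : 'I_a -> R) (t : kterm a) : R :=
  match t with
  | KVar i => e i
  | KZero => 0
  | KOne => 1
  | KAdd t1 t2 => kterm_eval e t1 + kterm_eval e t2
  | KSub t1 t2 => kterm_eval e t1 - kterm_eval e t2
  | KMul t1 t2 => kterm_eval e t1 * kterm_eval e t2
  end.

Lemma eq_kterm_eval (R : pzRingType) a (e1 e2 : 'I_a -> R) t :
  e1 =1 e2 -> kterm_eval e1 t = kterm_eval e2 t.
Proof. by move=> eqe; elim: t => //= t1 -> t2 ->. Qed.

Lemma rmorph_kterm_eval (R S : pzRingType) (f : {rmorphism R -> S}) a
    (e : 'I_a -> R) t :
  f (kterm_eval e t) = kterm_eval (f \o e) t.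
Proof.
elim: t => //= [|| t1 <- t2 <- | t1 <- t2 <- | t1 <- t2 <-].
- exact: rmorph0.
- exact: rmorph1.
- exact: rmorphD.
- exact: rmorphB.
- exact: rmorphM.
Qed.

(* The characteristic polynomial of [sum_i u_i C^i]; when C is the companion
   matrix of g, it is that of the element [sum_i u_i x^i] of K[x]/(g). *)
Definition mx_char_poly (R : comNzRingType) n (C : 'M[R]_n.+1)
    (u : 'rV[R]_n.+1) : {poly R} :=
  char_poly (horner_mx C (rVpoly u)).

Lemma map_mx_char_poly (R S : comNzRingType) (f : {rmorphism R -> S}) n
    (C : 'M[R]_n.+1) u :
  map_poly f (mx_char_poly C u) = mx_char_poly (map_mx f C) (map_mx f u).
Proof. by rewrite /mx_char_poly map_char_poly map_horner_mx map_rVpoly. Qed.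

(** The variables of [t] stand for the coefficients of degree at most [n]; the one of degree [n.+1]
    is always 1. *)
Definition char_kterm (R : comNzRingType) n (C : 'M[R]_n.+1)
    (t : kterm n.+1) (u : 'rV[R]_n.+1) : R :=
  kterm_eval (fun i : 'I_n.+1 => (mx_char_poly C u)`_i) t.

Lemma map_char_kterm (R S : comNzRingType) (f : {rmorphism R -> S}) n
    (C : 'M[R]_n.+1) t u :
  f (char_kterm C t u) = char_kterm (map_mx f C) t (map_mx f u).
Proof.
rewrite /char_kterm rmorph_kterm_eval; apply: eq_kterm_eval => i /=.
by rewrite -map_mx_char_poly coef_map.
Qed.

(** A substitute for polynomial functions of several variables: the nonvanishing arguments below
    only ever restrict to a line. *)
Definition polynomial_on_lines (K : fieldType) m (f : 'rV[K]_m -> K) :=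
  forall u w, exists q : {poly K}, forall s, f (u + s *: w) = q.[s].

(** The polynomial is the same expression computed over K[X] at the generic point [u] + X [w] of the
    line, since evaluation at [s] is a ring morphism. *)
Lemma char_kterm_on_lines (K : fieldType) n (C : 'M[K]_n.+1) t :
  polynomial_on_lines (char_kterm C t).
Proof.
move=> u w; exists (char_kterm (map_mx polyC C) t
  (map_mx polyC u + 'X *: map_mx polyC w)) => s.
rewrite -[RHS]/(horner_eval s _) map_char_kterm.
have -> : map_mx (horner_eval s) (map_mx polyC C) = C.
  by apply/matrixP=> i j; rewrite !mxE /horner_eval hornerC.
have -> // : map_mx (horner_eval s) (map_mx polyC u + 'X *: map_mx polyC w)
  = u + s *: w.
by apply/matrixP=> i j; rewrite !mxE /horner_eval !hornerE.
Qed.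

(** In characteristic 0 the natural numbers are distinct, so they cannot all be roots. Such nonroots
    lie in every subfield, which [lines_descend] exploits. *)
Lemma natr_nonroot (K : fieldType) (q : {poly K}) :
  [pchar K] =i pred0 -> q != 0 -> exists j : nat, q.[j%:R] != 0.
Proof.
move=> charK q0; apply: NNPP => all0.
have inj : injective (fun j : nat => j%:R : K).
  have natr0 := (pcharf0P K).1 charK.
  have le_inj (i j : nat) : (i <= j)%N -> i%:R = j%:R :> K -> i = j.
    move=> le_ij /eqP; rewrite eq_sym -subr_eq0 -natrB // natr0 subn_eq0 => le_ji.
    by apply/eqP; rewrite eqn_leq le_ij.
  move=> i j eqij; case: (leqP i j) => [/le_inj|/ltnW /le_inj]; first exact.
  by move=> /(_ (esym eqij)).
have := @max_poly_roots _ q [seq j%:R | j <- iota 0 (size q)] q0.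
rewrite map_inj_uniq // iota_uniq size_map size_iota ltnn => nomax.
suff: false by []; apply: nomax => //.
apply/allP=> _ /mapP[j _ ->]; apply: contraT => nz; case: all0.
by exists j.
Qed.

(** On the line through [u] and [w] both functions restrict to nonzero polynomials, whose product
    has a nonroot. *)
Lemma lines_common_nonzero (K : fieldType) m (f g : 'rV[K]_m -> K) :
    [pchar K] =i pred0 ->
    polynomial_on_lines f -> polynomial_on_lines g ->
  forall u w, f u != 0 -> g w != 0 -> exists x, f x * g x != 0.
Proof.
move=> charK lf lg u w fu gw.
have [p Dp] := lf u (w - u); have [q Dq] := lg u (w - u).
have p0 : p != 0.
  by apply: contraNneq fu => p0; have := Dp 0; rewrite scale0r addr0 p0 horner0 => ->.
have q0 : q != 0.
  apply: contraNneq gw => q0; have := Dq 1.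
  by rewrite scale1r addrC subrK q0 horner0 => ->.
have [|j] := natr_nonroot charK (_ : p * q != 0); first by rewrite mulf_neq0.
by rewrite hornerM -Dp -Dq => nz; exists (u + j%:R *: (w - u)).
Qed.

Lemma linesM (K : fieldType) m (f g : 'rV[K]_m -> K) :
  polynomial_on_lines f -> polynomial_on_lines g ->
  polynomial_on_lines (fun x => f x * g x).
Proof.
move=> lf lg u w; have [p Dp] := lf u w; have [q Dq] := lg u w.
by exists (p * q) => s; rewrite hornerM -Dp -Dq.
Qed.

(** The coordinates of [w] are replaced one after the other by natural numbers, which come from
    [K]. *)
Lemma lines_descend (K F : fieldType) (phi : {rmorphism K -> F}) m
    (f : 'rV[F]_m -> F) (w : 'rV[F]_m) :
    [pchar K] =i pred0 -> polynomial_on_lines f -> f w != 0 ->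
  exists u : 'rV[K]_m, f (map_mx phi u) != 0.
Proof.
move=> charK lf fw.
have charF : [pchar F] =i pred0 by move=> q; rewrite (fmorph_pchar phi) charK.
suff /(_ m (leqnn m))[w' fw' w'K] : forall k, (k <= m)%N -> exists2 w' : 'rV[F]_m,
    f w' != 0 & forall i : 'I_m, (i < k)%N -> exists c : K, w' 0 i = phi c.
  have [u Du] : exists u : 'rV[K]_m, forall i, w' 0 i = phi (u 0 i).
    have /fin_all_exists[c Dc] : forall i, exists c, w' 0 i = phi c by move=> i; exact: w'K.
    by exists (\row_i c i) => i; rewrite mxE.
  by exists u; have -> : map_mx phi u = w' by apply/rowP=> i; rewrite mxE Du.
elim=> [_|k IHk lt_km]; first by exists w.
have [w' fw' w'K] := IHk (ltnW lt_km); pose k0 := Ordinal lt_km.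
have [q Dq] := lf w' (delta_mx 0 k0).
(* The shift makes the argument of the polynomial the new value of the coordinate rather than its
   increment. *)
have r0 : q \Po ('X - (w' 0 k0)%:P) != 0.
  apply: contraNneq fw' => r0; have := Dq 0; rewrite scale0r addr0 => ->.
  have := horner_comp q ('X - (w' 0 k0)%:P) (w' 0 k0).
  by rewrite r0 horner0 !hornerE subrr => <-.
have [j] := natr_nonroot charF r0; rewrite horner_comp !hornerE -Dq => nz.
exists (w' + (j%:R - w' 0 k0) *: delta_mx 0 k0) => // i.
rewrite ltnS leq_eqVlt !mxE /= => /predU1P[ik|lt_ik].
  have -> : i = k0 by apply: val_inj.
  by exists j%:R; rewrite eqxx mulr1 addrC subrK rmorph_nat.
rewrite [i == k0](_ : _ = false) ?mulr0 ?addr0; first exact: w'K.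
by apply/eqP=> ik; rewrite ik /= ltnn in lt_ik.
Qed.

Lemma separable_irreducible (K : fieldType) (g : {poly K}) :
  [pchar K] =i pred0 -> irreducible_poly g -> separable_poly g.
Proof.
move=> charK irr_g; rewrite separable_poly.unlock irreducible_poly_coprime //.
have [g_gt1 _] := irr_g; have g0 : g != 0 by apply: irredp_neq0.
apply: contraL (lt_size_deriv g0) => g_dvd; rewrite -leqNgt dvdp_leq //.
case Dn: (size g) g_gt1 => [|[|n]] // _.
apply/eqP=> /polyP /(_ n) /eqP; rewrite coef_deriv coef0 -mulr_natr mulf_eq0.
rewrite ((pcharf0P K).1 charK) orbF.
have -> : n.+1 = (size g).-1 by rewrite Dn.
by rewrite -/(lead_coef g) lead_coef_eq0 (negPf g0).
Qed.

Lemma interpolation (F : fieldType) n (d y : 'rV[F]_n) :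
  injective (d 0) -> exists u : 'rV[F]_n, forall i, (rVpoly u).[d 0 i] = y 0 i.
Proof.
move=> inj_d; have unitV : Vandermonde n d \in unitmx.
  rewrite unitmxE det_Vandermonde unitfE; apply/prodf_neq0 => i _.
  apply/prodf_neq0 => j lt_ij; rewrite subr_eq0; apply/eqP=> /inj_d eq_ji.
  by rewrite eq_ji ltnn in lt_ij.
exists (y *m invmx (Vandermonde n d)) => i.
set u := y *m _; have <- : (u *m Vandermonde n d) 0 i = y 0 i by rewrite mulmxKV.
rewrite (horner_coef_wide _ (size_poly _ _)) mxE; apply: eq_bigr => j _.
by rewrite coef_rVpoly_ord [Vandermonde _ _ _ _]mxE.
Qed.

Lemma char_poly_similar (F : fieldType) n (A B P : 'M[F]_n) :
  P \in unitmx -> P *m A = B *m P -> char_poly A = char_poly B.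
Proof.
move=> uP PA; rewrite /char_poly.
have : \det (map_mx polyC P) * \det (char_poly_mx A) =
    \det (char_poly_mx B) * \det (map_mx polyC P).
  rewrite -!det_mulmx /char_poly_mx mulmxBr mulmxBl -!map_mxM PA.
  by rewrite scalar_mxC.
rewrite mulrC => /mulIf; apply.
by rewrite det_map_mx polyC_eq0 -unitfE -unitmxE.
Qed.

(** Having distinct eigenvalues, [C] is diagonalizable, and a polynomial in [C] acts on each
    eigenvalue separately; interpolation sends the eigenvalues to the prescribed roots. *)
Lemma mx_char_poly_eq (F : fieldType) n (C : 'M[F]_n.+1) (zs ys : seq F) :
    char_poly C = \prod_(z <- zs) ('X - z%:P) -> uniq zs ->
    size ys = n.+1 ->
  exists u, mx_char_poly C u = \prod_(y <- ys) ('X - y%:P).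
Proof.
move=> charC uniq_zs size_ys.
have [|P uP /(similar_diagLR uP)[D DC]] := (diagonalizableP C).2.
  by exists zs => //; rewrite -charC mxminpoly_dvd_char.
rewrite conjVmx // in DC.
have similar_char E : char_poly (invmx P *m diag_mx E *m P) =
    \prod_(i < n.+1) ('X - (E 0 i)%:P).
  rewrite (@char_poly_similar _ _ _ (diag_mx E) P) //; last first.
    by rewrite -mulmxA mulKVmx.
  rewrite char_poly_trig ?diag_mx_is_trig //.
  by apply: eq_bigr => i _; rewrite mxE eqxx mulr1n.
have injD : injective (D 0).
  have : uniq [seq D 0 i | i <- index_enum 'I_n.+1].
    rewrite -separable_prod_XsubC big_map -similar_char -DC charC.
    by rewrite separable_prod_XsubC.
  by move=> uniqD i j; apply: (injectiveP _ _) => //; rewrite /injectiveb /dinjectiveb enumT.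
have [u Du] := interpolation (\row_i ys`_i) injD.
exists u; rewrite /mx_char_poly DC horner_mx_uconjC // horner_mx_diag similar_char.
rewrite [RHS](big_nth 0) size_ys big_mkord; apply: eq_bigr => i _.
by rewrite mxE Du mxE.
Qed.

(** The point [a] gives the lower coefficients of a monic [p]. Over a field that splits both [p] and
    [g], [p] is itself the characteristic polynomial attached to some [u]; [lines_descend] then
    moves [u] to [K]. *)
Lemma char_kterm_neq0 (K : fieldType) n (C : 'M[K]_n.+1) (t : kterm n.+1)
    (a : 'I_n.+1 -> K) :
    [pchar K] =i pred0 -> irreducible_poly (char_poly C) ->
    kterm_eval a t != 0 ->
  exists u, char_kterm C t u != 0.
Proof.
move=> charK irr_g; set g := char_poly C in irr_g * => ta.
pose p : {poly K} := 'X^(n.+1) + \poly_(i < n.+1) a (inord i).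
have size_p : size p = n.+2 by rewrite size_polyDl size_polyXn // ltnS size_poly.
have monic_p : p \is monic.
  by rewrite monicE lead_coefDl ?lead_coefXn // size_polyXn ltnS size_poly.
have [|F [f [rs Drs]]] := @splitting_extension K (p * g).
  by apply: mulf_neq0; [apply: monic_neq0 | apply: irredp_neq0].
have split_dvd q : q \is monic -> q %| p * g ->
    exists s, map_poly f q = \prod_(x <- s) ('X - x%:P).
  move=> monic_q q_dvd; have : map_poly f q %| \prod_(x <- rs) ('X - x%:P).
    by rewrite -(eqp_dvdr _ Drs) dvdp_map.
  move=> /dvdp_prod_XsubC[m]; rewrite eqp_monic ?monic_prod_XsubC ?map_monic //.
  by move=> /eqP->; exists (mask m rs).
have [ys Dys] := split_dvd p monic_p (dvdp_mulr _ (dvdpp _)).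
have [zs Dzs] := split_dvd g (char_poly_monic _) (dvdp_mull _ (dvdpp _)).
have [|||u Du] := @mx_char_poly_eq F n (map_mx f C) zs ys.
- by rewrite -map_char_poly.
- rewrite -separable_prod_XsubC -Dzs separable_map.
  exact: separable_irreducible.
- by have := size_map_poly f p; rewrite Dys size_prod_XsubC size_p => -[].
have [||v nz] := @lines_descend K F f _ (char_kterm (map_mx f C) t) u charK.
- exact: char_kterm_on_lines.
- rewrite /char_kterm Du -Dys (eq_kterm_eval (e2 := f \o a)).
    by rewrite -rmorph_kterm_eval fmorph_eq0.
  move=> i; rewrite coef_map coefD coefXn coef_poly ltn_ord inord_val.
  by rewrite ltn_eqF // add0r.
by exists v; rewrite -map_char_kterm fmorph_eq0 in nz.
Qed.

(** The induction carries one function [f], the product of the conditions met so far: where it is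
    nonzero, all of them hold. The inner quantifier over [a] restricts the claim to terms that are
    not identically zero. *)
Lemma char_kterms_neq0 (K : fieldType) n (C : 'M[K]_n.+2) (T : seq (kterm n.+2)) :
    [pchar K] =i pred0 -> irreducible_poly (char_poly C) ->
  exists u : 'rV[K]_n.+2, u 0 1 != 0 /\
    forall t, List.In t T -> forall a : 'I_n.+2 -> K, kterm_eval a t != 0 ->
      char_kterm C t u != 0.
Proof.
move=> charK irr_g.
suff [f lf [u fu ft]] : exists2 f : 'rV[K]_n.+2 -> K, polynomial_on_lines f &
    exists2 u, f u != 0 & forall u, f u != 0 -> u 0 1 != 0 /\
    forall t, List.In t T -> forall a : 'I_n.+2 -> K, kterm_eval a t != 0 ->
      char_kterm C t u != 0.
  by exists u; apply: ft.
elim: T => [|t T [f lf [u fu ft]]].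
  (* This first factor keeps [u] from being a scalar. *)
  exists (fun u => u 0 1).
    move=> u w; exists ((u 0 1)%:P + (w 0 1) *: 'X) => s.
    by rewrite !mxE !hornerE mulrC.
  by exists (const_mx 1); [rewrite mxE oner_neq0 | split].
case: (classic (exists a : 'I_n.+2 -> K, kterm_eval a t != 0)) => [[a ta]|no_a]; last first.
  exists f => //; exists u => // w fw; have [w1 fT] := ft w fw.
  by split=> // t' [<-|/fT //] a ta; case: no_a; exists a.
have [w tw] := char_kterm_neq0 charK irr_g ta.
have lt := char_kterm_on_lines C t.
have [x nz] := lines_common_nonzero charK lf lt fu tw.
exists (fun x => f x * char_kterm C t x); first exact: linesM.
exists x => // y; rewrite mulf_eq0 negb_or => /andP[fy ty].
have [y1 fT] := ft y fy; split=> // t' [<- //|]; exact: fT.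
Qed.

(** * The field K[X]/(g) realized by matrices *)

Lemma horner_mx_comp_poly (R : comNzRingType) n (C : 'M[R]_n.+1) (p q : {poly R}) :
  horner_mx C (p \Po q) = horner_mx (horner_mx C q) p.
Proof.
elim/poly_ind: p => [|p c IHp]; first by rewrite comp_poly0 !rmorph0.
rewrite comp_polyD comp_polyM comp_polyX comp_polyC !rmorphD !rmorphM /= IHp.
by rewrite !horner_mx_X !horner_mx_C.
Qed.

(** By Cayley-Hamilton, a Bezout relation between the two polynomials becomes an inverse of q(C). *)
Lemma coprime_horner_mx (K : fieldType) n (C : 'M[K]_n.+1) (q : {poly K}) :
  coprimep (char_poly C) q -> exists B, B *m horner_mx C q = 1%:M.
Proof.
move=> /Bezout_eq1_coprimepP[[a b] /= Dab]; exists (horner_mx C b).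
have := congr1 (horner_mx C) Dab.
by rewrite rmorphD !rmorphM /= Cayley_Hamilton mulr0 add0r rmorph1.
Qed.

(** A root [x] would make u(C) - x singular. But u - x is a nonzero polynomial of degree smaller
    than the irreducible characteristic polynomial of [C], hence coprime to it and invertible at
    [C]. *)
Lemma mx_char_poly_rootN (K : fieldType) n (C : 'M[K]_n.+2)
    (u : 'rV[K]_n.+2) (x : K) :
  irreducible_poly (char_poly C) -> u 0 1 != 0 -> ~~ root (mx_char_poly C u) x.
Proof.
move=> irr_g u1; rewrite -eigenvalue_root_char; apply/negP=> /eigenvalueP[w wA w0].
have [|B BA] := @coprime_horner_mx _ _ C (rVpoly u - x%:P).
  rewrite irreducible_poly_coprime //; apply/negP=> /dvdp_leq.
  have nz : rVpoly u - x%:P != 0.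
    apply: contraNneq u1 => /polyP/(_ 1); rewrite coefB coefC coef0 subr0.
    by rewrite (coef_rVpoly_ord u 1) => ->.
  move=> /(_ nz); rewrite size_char_poly leqNgt ltnS.
  rewrite (leq_trans (size_polyD _ _)) // geq_max size_polyN size_poly.
  exact: leq_trans (size_polyC_leq1 _) _.
case/eqP: w0; rewrite -[w]mulmx1 -(mulmx1C BA) mulmxA.
by rewrite rmorphB /= horner_mx_C mulmxBr wA mul_mx_scalar subrr mul0mx.
Qed.

(** Otherwise irreducibility would make chi_u(u(C)) invertible, while it is 0 by Cayley-Hamilton. In
    K[X]/(g) this means that [u] is a root of chi_u. *)
Lemma dvdp_mx_char_poly_comp (K : fieldType) n (C : 'M[K]_n.+1) u :
  irreducible_poly (char_poly C) ->
  char_poly C %| mx_char_poly C u \Po rVpoly u.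
Proof.
move=> irr_g; apply: contraT; rewrite -irreducible_poly_coprime //.
move=> /coprime_horner_mx[B]; rewrite horner_mx_comp_poly Cayley_Hamilton mulmx0.
by move=> /matrixP/(_ 0 0)/eqP; rewrite !mxE eq_sym oner_eq0.
Qed.

Lemma char_poly_exists (R : comNzRingType) n (g : {poly R}) :
  g \is monic -> size g = n.+1 -> exists C : 'M[R]_n, char_poly C = g.
Proof.
move=> monic_g size_g; have -> : n = (size g).-1 by rewrite size_g.
by exists (companionmx g); apply: companionmxK.
Qed.

(** * Definable subsets of the value group *)

Definition lift_renaming n n' (r : 'I_n -> 'I_n') (i : 'I_n.+1) : 'I_n'.+1 :=
  if unlift ord0 i is Some j then lift ord0 (r j) else ord0.

Fixpoint pres_term_rename n n' (r : 'I_n -> 'I_n') (t : pres_term n) :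
    pres_term n' :=
  match t with
  | PVar i => PVar (r i)
  | PZero => PZero n'
  | POne => POne n'
  | PAdd t1 t2 => PAdd (pres_term_rename r t1) (pres_term_rename r t2)
  end.

Fixpoint pres_rename n n' (r : 'I_n -> 'I_n') (f : pres_formula n) :
    pres_formula n' :=
  match f with
  | PEq t1 t2 => PEq (pres_term_rename r t1) (pres_term_rename r t2)
  | PLt t1 t2 => PLt (pres_term_rename r t1) (pres_term_rename r t2)
  | PDvd m m_gt1 t => PDvd m_gt1 (pres_term_rename r t)
  | PNot f1 => PNot (pres_rename r f1)
  | PAnd f1 f2 => PAnd (pres_rename r f1) (pres_rename r f2)
  | POr f1 f2 => POr (pres_rename r f1) (pres_rename r f2)
  | PImp f1 f2 => PImp (pres_rename r f1) (pres_rename r f2)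
  | PEx f1 => PEx (pres_rename (lift_renaming r) f1)
  | PAll f1 => PAll (pres_rename (lift_renaming r) f1)
  end.

Section Presburger.
Variable M : pres_structure.

Lemma pres_eval_rename n n' (r : 'I_n -> 'I_n') (e : n.-tuple M)
    (e' : n'.-tuple M) t :
  (forall i, tnth e' (r i) = tnth e i) ->
  pres_eval e' (pres_term_rename r t) = pres_eval e t.
Proof. by move=> re; elim: t => //= t1 -> t2 ->. Qed.

Lemma pres_sat_rename n n' (r : 'I_n -> 'I_n') (e : n.-tuple M)
    (e' : n'.-tuple M) f :
  (forall i, tnth e' (r i) = tnth e i) ->
  pres_sat e' (pres_rename r f) <-> pres_sat e f.
Proof.
elim: f n' r e e' => {n} n.
- by move=> t1 t2 n' r e e' re /=; rewrite !(pres_eval_rename _ re).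
- by move=> t1 t2 n' r e e' re /=; rewrite !(pres_eval_rename _ re).
- by move=> m m_gt1 t n' r e e' re /=; rewrite !(pres_eval_rename _ re).
- by move=> f IH n' r e e' re /=; rewrite (IH _ _ _ _ re).
- by move=> f1 IH1 f2 IH2 n' r e e' re /=; rewrite (IH1 _ _ _ _ re) (IH2 _ _ _ _ re).
- by move=> f1 IH1 f2 IH2 n' r e e' re /=; rewrite (IH1 _ _ _ _ re) (IH2 _ _ _ _ re).
- by move=> f1 IH1 f2 IH2 n' r e e' re /=; rewrite (IH1 _ _ _ _ re) (IH2 _ _ _ _ re).
- move=> f IH n' r e e' re /=.
  have re' x (i : 'I_n.+1) :
      tnth [tuple of x :: e'] (lift_renaming r i) = tnth [tuple of x :: e] i.
    by rewrite /lift_renaming; case: (unliftP ord0 i) => [j|] ->; rewrite ?tnthS ?tnth0.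
  by split=> -[x fx]; exists x;
    [rewrite -(IH _ _ _ _ (re' x)) | rewrite (IH _ _ _ _ (re' x))].
- move=> f IH n' r e e' re /=.
  have re' x (i : 'I_n.+1) :
      tnth [tuple of x :: e'] (lift_renaming r i) = tnth [tuple of x :: e] i.
    by rewrite /lift_renaming; case: (unliftP ord0 i) => [j|] ->; rewrite ?tnthS ?tnth0.
  by split=> fx x; [rewrite -(IH _ _ _ _ (re' x)) | rewrite (IH _ _ _ _ (re' x))].
Qed.

(** Elementary equivalence concerns sentences, so parameters are universally quantified before a
    formula is transferred. *)
Fixpoint pres_closure m : pres_formula m -> pres_formula 0 :=
  match m with
  | 0 => id
  | m'.+1 => fun f => pres_closure (PAll f)
  end.

Lemma pres_sat_closure m (f : pres_formula m) :
  pres_sat ([tuple] : 0.-tuple M) (pres_closure f) <->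
  forall e : m.-tuple M, pres_sat e f.
Proof.
elim: m f => [|m IHm] f /=.
  by split=> [f0 e|]; [rewrite (tuple0 e) | apply].
rewrite IHm; split=> [fall e|fall e x]; last exact: fall.
by have := fall (behead_tuple e) (thead e); rewrite -tuple_eta.
Qed.

Definition pres_has_max (D : M -> Prop) : Prop :=
  (exists x, D x) /\ (exists b, forall x, D x -> ~ plt b x) ->
  exists x, D x /\ forall y, D y -> ~ plt x y.

End Presburger.

(** In [ub], variable 0 runs over the set and variable 1 is the candidate bound; the renaming of [f]
    skips the latter. *)
Definition pres_max_formula m (f : pres_formula m.+1) : pres_formula m :=
  let ub := PAll (PImp (pres_rename (lift_renaming (lift ord0)) f)
                       (PNot (PLt (PVar (lift ord0 ord0)) (PVar ord0)))) in
  PImp (PAnd (PEx f) (PEx ub)) (PEx (PAnd f ub)).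

Lemma pres_sat_max_formula (M : pres_structure) m (f : pres_formula m.+1)
    (e : m.-tuple M) :
  pres_sat e (pres_max_formula f) <->
  pres_has_max (fun x => pres_sat [tuple of x :: e] f).
Proof.
have ren x y : pres_sat [tuple of y :: [tuple of x :: e]]
    (pres_rename (lift_renaming (lift ord0)) f) <-> pres_sat [tuple of y :: e] f.
  apply: pres_sat_rename => i.
  by rewrite /lift_renaming; case: (unliftP ord0 i) => [j|] ->; rewrite ?tnthS ?tnth0.
rewrite /pres_has_max /=; split=> max -[ex [b ub]].
  have [|x [fx xub]] := max.
    by split=> //; exists b => y /ren/ub; rewrite tnthS !tnth0.
  by exists x; split=> // y /ren/xub; rewrite tnthS !tnth0.
have [|x [fx xub]] := max.
  by split=> //; exists b => y /(ren b)/ub; rewrite tnthS !tnth0.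
by exists x; split=> // y /ren/xub; rewrite tnthS !tnth0.
Qed.

Lemma int_has_max (D : int -> Prop) :
  @pres_has_max (pres_of (1 : int)) D.
Proof.
move=> [[x Dx] [b ub]] /=.
apply: NNPP => nomax.
(* Here [n] bounds the distance from [y] up to [b]; an element that is not maximal has a larger one
   in [D], for which a smaller [n] will do. *)
suff noD n (y : int) : b <= y + n%:Z -> ~ D y.
  apply: (noD `|b - x|%N x) Dx; rewrite -lerBlDl; exact: lez_abs.
elim: n y => [|n IHn] y le_by Dy.
  apply: nomax; exists y; split=> // z Dz /= lt_yz; apply: (ub z Dz).
  by rewrite addr0 in le_by; apply: le_lt_trans lt_yz.
apply: nomax; exists y; split=> // z Dz /= lt_yz; apply: (IHn z) Dz.
rewrite (le_trans le_by) // -addn1 PoszD addrC -addrA addrC lerD2r.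
by rewrite addrC lezD1.
Qed.

(** For a fixed formula, the existence of maxima for all values of the parameters is a single
    sentence, true in the integers. *)
Lemma Zgroup_has_max (G : porderZmodType) (one : G) m (e : m.-tuple G) f :
  Zgroup one ->
  @pres_has_max (pres_of one) (fun x => pres_sat (M := pres_of one) [tuple of x :: e] f).
Proof.
move=> [_ _ elem_eq].
have [_ back] := elem_eq (pres_closure (pres_max_formula f)).
apply/pres_sat_max_formula; apply: (pres_sat_closure (pres_of one) _).1 e.
apply/back/pres_sat_closure => e.
by apply/pres_sat_max_formula/int_has_max.
Qed.

(** * Separation of the residue field from the value group *)

Fixpoint rterm_kterms a b (t : rterm a b) : seq (kterm a) :=
  match t with
  | RVar _ | RZero | ROne => [::]
  | RAdd t1 t2 | RSub t1 t2 | RMul t1 t2 => rterm_kterms t1 ++ rterm_kterms t2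
  | RAc t1 => [:: t1]
  end.

Fixpoint gterm_kterms a c (t : gterm a c) : seq (kterm a) :=
  match t with
  | GVar _ | GZero | GOne | GInfty => [::]
  | GAdd t1 t2 => gterm_kterms t1 ++ gterm_kterms t2
  | GVal t1 => [:: t1]
  end.

(* Only meaningful on formulas without K-quantifiers.  An equation is recorded
   as the difference of its sides. *)
Fixpoint formula_kterms a b c (f : formula a b c) : seq (kterm a) :=
  match f with
  | KEq t1 t2 => [:: KSub t1 t2]
  | REq t1 t2 => rterm_kterms t1 ++ rterm_kterms t2
  | GEq t1 t2 | GLt t1 t2 => gterm_kterms t1 ++ gterm_kterms t2
  | GDvd _ _ t => gterm_kterms t
  | FNot f1 => formula_kterms f1
  | FAnd f1 f2 | FOr f1 f2 | FImp f1 f2 => formula_kterms f1 ++ formula_kterms f2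
  | KEx _ | KAll _ => [::]
  | REx f1 | RAll f1 => formula_kterms f1
  | GEx f1 | GAll f1 => formula_kterms f1
  end.

Lemma In_catl T (x : T) s1 s2 : List.In x s1 -> List.In x (s1 ++ s2).
Proof. by move=> xs; apply/List.in_or_app; left. Qed.

Lemma In_catr T (x : T) s1 s2 : List.In x s2 -> List.In x (s1 ++ s2).
Proof. by move=> xs; apply/List.in_or_app; right. Qed.

Section Separation.
Variables (K k : fieldType) (G : porderZmodType) (one : G).
Variables (v : K -> option G) (ac : K -> k).
Variables (m : nat) (p : m.-tuple G).
Let S := rrp_structure_of v one ac.
Let P := pres_of one.

Definition pres_true n : pres_formula n := PEq (PZero n) (PZero n).
Definition pres_false n : pres_formula n := PNot (pres_true n).

(* Every residue-field fibre of the relation is one of finitely many sets,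
   each definable in the value group with parameters [p]; this is what
   separates the residue-field quantifiers from those over the value group. *)
Definition finitely_many_fibres b c
    (X : b.-tuple k -> c.-tuple G -> Prop) : Prop :=
  exists L : seq (pres_formula (c + m)), forall er, exists B, List.In B L /\
    forall e : c.-tuple G, X er e <-> pres_sat (M := P) [tuple of e ++ p] B.

Lemma fibres_ext b c (X Y : b.-tuple k -> c.-tuple G -> Prop) :
  (forall er e, X er e <-> Y er e) ->
  finitely_many_fibres X -> finitely_many_fibres Y.
Proof.
move=> XY [L LX]; exists L => er; have [B [BL XB]] := LX er.
by exists B; split=> // e; rewrite -XY.
Qed.

Lemma fibres_const b c (Q : b.-tuple k -> Prop) :
  finitely_many_fibres (fun er (_ : c.-tuple G) => Q er).
Proof.
exists [:: pres_true _; pres_false _] => er.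
case: (classic (Q er)) => Qer.
  by exists (pres_true _); split=> [|e]; [left | split].
by exists (pres_false _); split=> [|e]; [right; left | split=> // -[]].
Qed.

Lemma fibres_pres b c (B : pres_formula (c + m)) :
  finitely_many_fibres
    (fun (_ : b.-tuple k) e => pres_sat (M := P) [tuple of e ++ p] B).
Proof. by exists [:: B] => er; exists B; split=> //; left. Qed.

Lemma fibres_not b c (X : b.-tuple k -> c.-tuple G -> Prop) :
  finitely_many_fibres X -> finitely_many_fibres (fun er e => ~ X er e).
Proof.
move=> [L LX]; exists (map (@PNot _) L) => er; have [B [BL XB]] := LX er.
by exists (PNot B); split=> [|e /=]; [apply: List.in_map | rewrite XB].
Qed.

Lemma fibres_or b c (X Y : b.-tuple k -> c.-tuple G -> Prop) :
  finitely_many_fibres X -> finitely_many_fibres Y ->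
  finitely_many_fibres (fun er e => X er e \/ Y er e).
Proof.
move=> [L LX] [N NY]; exists (List.flat_map (fun B => map (POr B) N) L) => er.
have [[B [BL XB]] [C [CN YC]]] := (LX er, NY er).
exists (POr B C); split=> [|e /=]; last by rewrite XB YC.
by apply/List.in_flat_map; exists B; split=> //; apply: List.in_map.
Qed.

Lemma fibres_and b c (X Y : b.-tuple k -> c.-tuple G -> Prop) :
  finitely_many_fibres X -> finitely_many_fibres Y ->
  finitely_many_fibres (fun er e => X er e /\ Y er e).
Proof.
move=> fX fY; apply: fibres_ext (fibres_not (fibres_or (fibres_not fX) (fibres_not fY))).
by move=> er e; case: (classic (X er e)); case: (classic (Y er e)); tauto.
Qed.

Lemma fibres_imp b c (X Y : b.-tuple k -> c.-tuple G -> Prop) :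
  finitely_many_fibres X -> finitely_many_fibres Y ->
  finitely_many_fibres (fun er e => X er e -> Y er e).
Proof.
move=> fX fY; apply: fibres_ext (fibres_or (fibres_not fX) fY).
by move=> er e; case: (classic (X er e)); tauto.
Qed.

Fixpoint sublist_disjunctions n (L : seq (pres_formula n)) : seq (pres_formula n) :=
  if L is B :: L' then
    sublist_disjunctions L' ++ map (POr B) (sublist_disjunctions L')
  else [:: pres_false n].

Lemma sublist_disjunctionP n (L : seq (pres_formula n)) (Q : pres_formula n -> Prop) :
  exists D, List.In D (sublist_disjunctions L) /\
    forall e : n.-tuple P,
      pres_sat e D <-> exists B, [/\ List.In B L, Q B & pres_sat e B].
Proof.
elim: L => [|B L [D [DL satD]]] /=.
  exists (pres_false n); split=> [|e]; first by left.
  by split=> [[] //|[B []]].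
case: (classic (Q B)) => QB.
  exists (POr B D); split=> [|e /=].
    by apply/In_catr/List.in_map.
  rewrite satD; split=> [[eB|[C [CL QC eC]]]|[C [[<-|CL] QC eC]]].
  - by exists B; split=> //; left.
  - by exists C; split=> //; right.
  - by left.
  - by right; exists C.
exists D; split=> [|e]; first exact: In_catl.
rewrite satD; split=> [[C [CL QC eC]]|[C [[eqB|CL] QC eC]]].
- by exists C; split=> //; right.
- by rewrite -eqB in QC.
- by exists C.
Qed.

(** The new fibre over [er] is a union of fibres of [X], each defined by a formula of [L], hence is
    defined by the disjunction of a sublist of [L]. There are finitely many sublists, whatever the
    residue field is. *)
Lemma fibres_exR b c (X : b.+1.-tuple k -> c.-tuple G -> Prop) :
  finitely_many_fibres X ->
  finitely_many_fibres (fun er e => exists x, X [tuple of x :: er] e).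
Proof.
move=> [L LX]; exists (sublist_disjunctions L) => er.
have [D [DL satD]] := sublist_disjunctionP L (fun B => exists x, forall e,
  X [tuple of x :: er] e <-> pres_sat (M := P) [tuple of e ++ p] B).
exists D; split=> // e; rewrite satD; split=> [[x Xx]|[B [BL [x XB] satB]]].
  have [B [BL XB]] := LX [tuple of x :: er].
  by exists B; split=> //; [exists x | rewrite -XB].
by exists x; rewrite XB.
Qed.

Lemma fibres_exG b c (X : b.-tuple k -> c.+1.-tuple G -> Prop) :
  finitely_many_fibres X ->
  finitely_many_fibres (fun er e => exists x, X er [tuple of x :: e]).
Proof.
move=> [L LX]; exists (map (@PEx (c + m)) L) => er; have [B [BL XB]] := LX er.
have cons_cat x (e : c.-tuple G) :
    [tuple of x :: [tuple of e ++ p]] = [tuple of [tuple of x :: e] ++ p].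
  exact: val_inj.
exists (PEx B : pres_formula (c + m)); split=> [|e /=]; first exact: List.in_map.
by split=> -[x]; [rewrite XB -cons_cat | rewrite cons_cat -XB]; exists x.
Qed.

(** The flags [s] fix which variables are infinite, so that the others range over [G] as Presburger
    variables do. The entry of [e] at a flagged place is a dummy. *)
Definition with_infinity c (s : c.-tuple bool) (e : c.-tuple G) :
    c.-tuple (option G) :=
  [tuple if tnth s i then None else Some (tnth e i) | i < c].

Lemma with_infinity_cons c (s : c.-tuple bool) (e : c.-tuple G) d x :
  with_infinity [tuple of d :: s] [tuple of x :: e] =
  [tuple of (if d then None else Some x) :: with_infinity s e].
Proof.
apply: eq_from_tnth => i; rewrite tnth_mktuple.
by case: (unliftP ord0 i) => [j|] ->; rewrite ?tnthS ?tnth_mktuple ?tnth0.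
Qed.

Definition value_is_parameter a (ek : a.-tuple K) (t : kterm a) : Prop :=
  exists o : option 'I_m, v (keval (M := S) ek t) = omap (tnth p) o.

(** Whether the value is infinite depends on [s] and [ek] but not on [e], which is why [o] is chosen
    before [e]. *)
Lemma gterm_pres_term a c (ek : a.-tuple K) (t : gterm a c) (s : c.-tuple bool) :
  (forall t', List.In t' (gterm_kterms t) -> value_is_parameter ek t') ->
  exists o : option (pres_term (c + m)), forall e : c.-tuple G,
    geval (M := S) ek (with_infinity s e) t =
    omap (pres_eval (M := P) [tuple of e ++ p]) o.
Proof.
elim: t => [i||||t1 IH1 t2 IH2|t] /= ht.
- case Ds: (tnth s i); first by exists None => e; rewrite tnth_mktuple Ds.
  exists (Some (PVar (lshift m i))) => e.
  by rewrite tnth_mktuple Ds /= tnth_lshift.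
- by exists (Some (PZero _)).
- by exists (Some (POne _)).
- by exists None.
- have [|o1 Ho1] := IH1; first by move=> t' t1t'; apply/ht/In_catl.
  have [|o2 Ho2] := IH2; first by move=> t' t2t'; apply/ht/In_catr.
  exists (if (o1, o2) is (Some q1, Some q2) then Some (PAdd q1 q2) else None) => e.
  by rewrite Ho1 Ho2; case: o1 o2 {Ho1 Ho2} => [q1|] [q2|].
- have [|o Ho] := ht t; first by left.
  exists (omap (fun i => PVar (rshift c i)) o) => e; rewrite Ho.
  by case: o {Ho} => //= i; rewrite tnth_rshift.
Qed.

(** No field variable is bound, so [ek] stays fixed and contributes only parameters to the value
    group atoms, which become Presburger formulas. The other atoms do not involve [e], and a
    quantifier over the value sort splits into an infinite and a finite case. *)
Lemma fibres_sat a b c (ek : a.-tuple K) (f : formula a b c) (s : c.-tuple bool) :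
    Kquantifier_free f ->
    (forall t, List.In t (formula_kterms f) -> value_is_parameter ek t) ->
  finitely_many_fibres
    (fun er e => sat (M := S) ek er (with_infinity s e) f).
Proof.
have omap_inj n (e : n.-tuple G) q1 q2 :
    omap (pres_eval (M := P) e) (Some q1) = omap (pres_eval (M := P) e) (Some q2) <->
    pres_eval (M := P) e q1 = pres_eval (M := P) e q2.
  by split=> [[]|/= ->].
elim: f ek s => {a b c} a b c.
- by move=> t1 t2 ek s _ _; apply: fibres_const.
- move=> t1 t2 ek s _ _ /=.
  exact: (fibres_const _ (fun er => reval (M := S) ek er t1 = reval (M := S) ek er t2)).
- move=> t1 t2 ek s _ /= ht.
  have [|o1 Ho1] := @gterm_pres_term _ _ ek t1 s; first by move=> t t1t; apply/ht/In_catl.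
  have [|o2 Ho2] := @gterm_pres_term _ _ ek t2 s; first by move=> t t2t; apply/ht/In_catr.
  case: o1 o2 Ho1 Ho2 => [q1|] [q2|] Ho1 Ho2.
  + apply: fibres_ext (fibres_pres _ (PEq q1 q2)) => er e.
    by rewrite Ho1 Ho2 omap_inj.
  + by apply: fibres_ext (fibres_const _ (fun _ => False)) => er e; rewrite Ho1 Ho2.
  + by apply: fibres_ext (fibres_const _ (fun _ => False)) => er e; rewrite Ho1 Ho2.
  + by apply: fibres_ext (fibres_const _ (fun _ => True)) => er e; rewrite Ho1 Ho2.
- move=> t1 t2 ek s _ /= ht.
  have [|o1 Ho1] := @gterm_pres_term _ _ ek t1 s; first by move=> t t1t; apply/ht/In_catl.
  have [|o2 Ho2] := @gterm_pres_term _ _ ek t2 s; first by move=> t t2t; apply/ht/In_catr.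
  case: o1 o2 Ho1 Ho2 => [q1|] [q2|] Ho1 Ho2.
  + by apply: fibres_ext (fibres_pres _ (PLt q1 q2)) => er e; rewrite Ho1 Ho2.
  + by apply: fibres_ext (fibres_const _ (fun _ => True)) => er e; rewrite Ho1 Ho2.
  + by apply: fibres_ext (fibres_const _ (fun _ => False)) => er e; rewrite Ho1 Ho2.
  + by apply: fibres_ext (fibres_const _ (fun _ => False)) => er e; rewrite Ho1 Ho2.
- move=> d d_gt1 t ek s _ /= ht.
  have [//|[q|] Ho] := @gterm_pres_term _ _ ek t s.
    by apply: fibres_ext (fibres_pres _ (PDvd d_gt1 q)) => er e; rewrite Ho.
  by apply: fibres_ext (fibres_const _ (fun _ => True)) => er e; rewrite Ho.
- by move=> f IH ek s /= qf ht; apply/fibres_not/IH.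
- move=> f1 IH1 f2 IH2 ek s /= /andP[qf1 qf2] ht.
  apply: fibres_and; [apply: IH1 | apply: IH2] => // t ft; apply: ht;
    [exact: In_catl | exact: In_catr].
- move=> f1 IH1 f2 IH2 ek s /= /andP[qf1 qf2] ht.
  apply: fibres_or; [apply: IH1 | apply: IH2] => // t ft; apply: ht;
    [exact: In_catl | exact: In_catr].
- move=> f1 IH1 f2 IH2 ek s /= /andP[qf1 qf2] ht.
  apply: fibres_imp; [apply: IH1 | apply: IH2] => // t ft; apply: ht;
    [exact: In_catl | exact: In_catr].
- by [].
- by [].
- move=> f IH ek s /= qf ht.
  exact: fibres_exR (IH ek s qf ht).
- move=> f IH ek s /= qf ht.
  apply: fibres_ext (fibres_not (fibres_exR (fibres_not (IH ek s qf ht)))) => er e.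
  split=> [nex x|fx [x]]; last exact.
  by apply: NNPP => nfx; apply: nex; exists x.
- move=> f IH ek s /= qf ht.
  have IHd d := fibres_exG (IH ek [tuple of d :: s] qf ht).
  apply: fibres_ext (fibres_or (IHd true) (IHd false)) => er e.
  split=> [[[x fx]|[x fx]]|[[x|] fx]]; last first.
  + by left; exists 0; rewrite with_infinity_cons.
  + by right; exists x; rewrite with_infinity_cons.
  + by rewrite with_infinity_cons in fx; exists (Some x).
  + by rewrite with_infinity_cons in fx; exists None.
- move=> f IH ek s /= qf ht.
  have IHd d := fibres_exG (fibres_not (IH ek [tuple of d :: s] qf ht)).
  apply: fibres_ext (fibres_not (fibres_or (IHd true) (IHd false))) => er e.
  split=> [nex x|fx [[x]|[x]]]; last first.
  + by rewrite with_infinity_cons; apply; apply: (fx (Some x)).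
  + by rewrite with_infinity_cons; apply; apply: (fx None).
  apply: NNPP => nfx; apply: nex; case: x nfx => [x|] nfx.
    by right; exists x; rewrite with_infinity_cons.
  by left; exists 0; rewrite with_infinity_cons.
Qed.

End Separation.

(** Once [er] is fixed, [fibres_sat] leaves a single Presburger formula with parameters in [G]. *)
Lemma Kqf_has_max (K k : fieldType) (G : porderZmodType) (one : G)
    (v : K -> option G) (ac : K -> k) a b (ek : a.-tuple K) (er : b.-tuple k)
    (f : formula a b 1) :
  Zgroup one -> Kquantifier_free f ->
  @pres_has_max (pres_of one)
    (fun x => sat (M := rrp_structure_of v one ac) ek er [tuple Some x] f).
Proof.
move=> hG qf.
pose S := rrp_structure_of v one ac.
(* Infinite values get the default 0, harmlessly: [value_is_parameter] is proved with [None] for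
   them. *)
pose p := in_tuple [seq odflt 0 (v (keval (M := S) ek t)) | t <- formula_kterms f].
have [t ft|L HL] := @fibres_sat K k G one v ac _ p a b 1 ek f [tuple false] qf.
  case Dv: (v (keval (M := S) ek t)) => [w|]; last by exists None.
  have w_in : w \in [seq odflt 0 (v (keval (M := S) ek t)) | t <- formula_kterms f].
    rewrite -[w]/(odflt 0 (Some w)) -Dv.
    elim: (formula_kterms f) ft => //= t' T IHT [->|/IHT tT].
      by rewrite inE eqxx.
    by rewrite inE tT orbT.
  have /tnthP[i Di] : w \in p by exact: w_in.
  by exists (Some i); rewrite [LHS]Dv /= -Di.
have [B [_ satB]] := HL er.
have Dsat (x : G) : sat (M := S) ek er [tuple Some x] f <->
    pres_sat (M := pres_of one) [tuple of x :: p] B.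
  have := satB [tuple x].
  have -> : with_infinity [tuple false] [tuple x] = [tuple Some x].
    by apply: eq_from_tnth => i; rewrite tnth_mktuple (ord1 i).
  have -> // : [tuple of [tuple x] ++ p] = [tuple of x :: p].
  exact: val_inj.
have max := @Zgroup_has_max G one _ p B hG.
move=> [[x Dx] [u ub]].
have [|y [Dy ymax]] := max.
  split; first by exists x; apply/Dsat.
  by exists u => y /Dsat/ub.
by exists y; split; [apply/Dsat | move=> z /Dsat/ymax].
Qed.

(** * Valuations and Newton's iteration *)

Lemma keval_kterm_eval (K k : fieldType) (G : porderZmodType) (one : G)
    (v : K -> option G) (ac : K -> k) a (ek : a.-tuple K) (t : kterm a) :
  keval (M := rrp_structure_of v one ac) ek t = kterm_eval (tnth ek) t.
Proof. by elim: t => //= t1 -> t2 ->. Qed.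

Section OrderedGroup.
Variable G : porderZmodType.
Hypothesis hG : ordered_abelian_group G.

Lemma og_leNgt (x y : G) : (x <= y) = ~~ (y < x).
Proof.
apply/idP/idP => [le_xy|]; first by rewrite le_gtF.
have /orP[// |le_yx] := hG.1 x y.
by rewrite lt_neqAle le_yx andbT negbK => /eqP ->.
Qed.

Lemma og_leD2r (z x y : G) : (x + z <= y + z) = (x <= y).
Proof.
apply/idP/idP => [/(hG.2 _ _ (- z))|/(hG.2 _ _ z)//].
by rewrite !addrK.
Qed.

Lemma og_ltD2r (z x y : G) : (x + z < y + z) = (x < y).
Proof. by rewrite !lt_neqAle og_leD2r (inj_eq (addIr z)). Qed.

Lemma og_leD (x y z t : G) : x <= y -> z <= t -> x + z <= y + t.
Proof.
move=> le_xy le_zt; apply: (@le_trans _ _ (y + z)); first by rewrite og_leD2r.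
by rewrite ![y + _]addrC og_leD2r.
Qed.

Lemma og_ltD (x y z t : G) : x < y -> z <= t -> x + z < y + t.
Proof.
move=> lt_xy le_zt; apply: (@lt_le_trans _ _ (y + z)); first by rewrite og_ltD2r.
by rewrite ![y + _]addrC og_leD2r.
Qed.

Lemma og_upper_bound (x y : G) : exists z, x <= z /\ y <= z.
Proof. by have /orP[le_xy|le_yx] := hG.1 x y; [exists y | exists x]. Qed.

End OrderedGroup.

Section Valuation.
Variables (K k : fieldType) (G : porderZmodType) (v : K -> option G).
Hypothesis hG : ordered_abelian_group G.
Hypothesis hv : is_valuation v.

Definition val_ge (g : G) (x : K) : bool := if v x is Some w then g <= w else true.
Definition val_gt (g : G) (x : K) : bool := if v x is Some w then g < w else true.

Lemma le_oo_val g x : le_oo (Some g) (v x) = val_ge g x.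
Proof. by rewrite /le_oo /val_ge; case: (v x) => //= w; rewrite le_eqVlt. Qed.

Lemma lt_oo_val g x : lt_oo (Some g) (v x) = val_gt g x.
Proof. by rewrite /val_gt; case: (v x). Qed.

Lemma val0 : v 0 = None. Proof. exact/(valuation_eq_oo hv). Qed.

Lemma val_ge0r g : val_ge g 0. Proof. by rewrite /val_ge val0. Qed.
Lemma val_gt0r g : val_gt g 0. Proof. by rewrite /val_gt val0. Qed.

Lemma val_some x : x != 0 -> exists w, v x = Some w.
Proof.
case Dv: (v x) => [w|] x0; first by exists w.
by case/eqP: x0; apply/(valuation_eq_oo hv).
Qed.

Lemma val_gtW g x : val_gt g x -> val_ge g x.
Proof. by rewrite /val_gt /val_ge; case: (v x) => // w; apply: ltW. Qed.

Lemma val_geNlt g x : val_ge g x = ~~ lt_oo (v x) (Some g).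
Proof. by rewrite /val_ge; case: (v x) => //= w; rewrite (og_leNgt hG). Qed.

Lemma val_ge_trans g h x : g <= h -> val_ge h x -> val_ge g x.
Proof. by rewrite /val_ge; case: (v x) => // w; apply: le_trans. Qed.

Lemma val_gt_trans g h x : g < h -> val_ge h x -> val_gt g x.
Proof. by rewrite /val_gt /val_ge; case: (v x) => // w; apply: lt_le_trans. Qed.

Lemma val_add x y a b c : v x = Some a -> v y = Some b -> v (x + y) = Some c ->
  (a <= c) || (b <= c).
Proof.
move=> Da Db Dc; have := valuationD hv x y; rewrite Da Db Dc /min_oo.
by case: ifP => _; rewrite /le_oo /= -[(_ == _) || _]le_eqVlt => ->; rewrite ?orbT.
Qed.

Lemma val_geD g x y : val_ge g x -> val_ge g y -> val_ge g (x + y).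
Proof.
have [->|/val_some[a Da]] := eqVneq x 0; first by rewrite add0r.
have [->|/val_some[b Db]] := eqVneq y 0; first by rewrite addr0.
rewrite /val_ge Da Db => ga gb; case Dc: (v (x + y)) => [c|] //.
by have /orP[] := val_add Da Db Dc; apply: le_trans.
Qed.

Lemma val_gtD g x y : val_gt g x -> val_gt g y -> val_gt g (x + y).
Proof.
have [->|/val_some[a Da]] := eqVneq x 0; first by rewrite add0r.
have [->|/val_some[b Db]] := eqVneq y 0; first by rewrite addr0.
rewrite /val_gt Da Db => ga gb; case Dc: (v (x + y)) => [c|] //.
by have /orP[] := val_add Da Db Dc; apply: lt_le_trans.
Qed.

Lemma val_geM g h x y : val_ge g x -> val_ge h y -> val_ge (g + h) (x * y).
Proof.
rewrite /val_ge (valuationM hv); case: (v x) => [a|] //; case: (v y) => [b|] //.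
exact: (og_leD hG).
Qed.

Lemma val_gtM g h x y : val_gt g x -> val_ge h y -> val_gt (g + h) (x * y).
Proof.
rewrite /val_gt /val_ge (valuationM hv); case: (v x) => [a|] //; case: (v y) => [b|] //.
exact: (og_ltD hG).
Qed.

Lemma val_ge0M x y : val_ge 0 x -> val_ge 0 y -> val_ge 0 (x * y).
Proof. by move=> x0 y0; rewrite -[0]addr0 val_geM. Qed.

Lemma val1 : v 1 = Some 0.
Proof.
have [w Dw] := val_some (oner_neq0 K); have := valuationM hv 1 1.
by rewrite mulr1 Dw /= => -[/eqP]; rewrite eq_sym -subr_eq0 addrK => /eqP ->.
Qed.

Lemma valN x : v (- x) = v x.
Proof.
have [|w Dw] := val_some (_ : -1 != 0 :> K); first by rewrite oppr_eq0 oner_neq0.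
(* Squaring -1 gives [w + w = 0], and an ordered group has no torsion. *)
have w0 : w = 0.
  have := valuationM hv (-1) (-1); rewrite mulrNN mulr1 val1 Dw /= => -[ww].
  apply/eqP; rewrite eq_le !(og_leNgt hG); apply/andP; split; apply/negP.
    by move=> w_gt0; have := og_ltD hG w_gt0 (ltW w_gt0); rewrite addr0 -ww ltxx.
  by move=> w_lt0; have := og_ltD hG w_lt0 (ltW w_lt0); rewrite addr0 -ww ltxx.
by rewrite -mulN1r (valuationM hv) Dw w0; case: (v x) => //= a; rewrite add0r.
Qed.

Lemma val_gtN g x : val_gt g (- x) = val_gt g x. Proof. by rewrite /val_gt valN. Qed.

Lemma val_unitV x : v x = Some 0 -> v x^-1 = Some 0.
Proof.
move=> Dx; have x0 : x != 0 by apply: contra_eq_neq Dx => ->; rewrite val0.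
have := valuationM hv x x^-1; rewrite mulfV // val1 Dx.
by case: (v x^-1) => //= w; rewrite add0r => <-.
Qed.

Lemma val_ultra x d w : v x = Some w -> val_gt w d -> v (x + d) = Some w.
Proof.
move=> Dx wd; have x_ge : val_ge w x by rewrite /val_ge Dx.
have := val_geD x_ge (val_gtW wd); rewrite /val_ge.
case De: (v (x + d)) => [c|].
  rewrite le_eqVlt => /predU1P[-> //|lt_wc].
  have : val_gt w (x + d - d) by rewrite val_gtD ?val_gtN // /val_gt De.
  by rewrite addrK /val_gt Dx ltxx.
have : val_gt w (x + d - d) by rewrite val_gtD ?val_gtN // /val_gt De.
by rewrite addrK /val_gt Dx ltxx.
Qed.

Lemma horner_bounded (q : {poly K}) :
  exists g, forall s, val_ge 0 s -> val_ge g q.[s].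
Proof.
elim/poly_ind: q => [|q c [g qg]]; first by exists 0 => s _; rewrite horner0 val_ge0r.
have [h hc] : exists h, val_ge h c.
  have [->|/val_some[w Dw]] := eqVneq c 0; first by exists 0; apply: val_ge0r.
  by exists w; rewrite /val_ge Dw.
have [m [mg mh]] : exists m, m <= g /\ m <= h.
  by have /orP[] := hG.1 g h; [exists g | exists h].
exists m => s s0; rewrite hornerMXaddC val_geD ?(val_ge_trans mh hc) //.
by apply: (val_ge_trans mg); rewrite -[g]addr0 val_geM ?qg.
Qed.

(** In x + d = (1 + d/x)x the factor 1 + d/x is a unit of residue 1, hence of angular component
    1. *)
Lemma ac_ultra (res ac : K -> k) x d w :
    is_residue_map v res -> is_angular_component v res ac ->
  v x = Some w -> val_gt w d -> ac (x + d) = ac x.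
Proof.
move=> hres hac Dx wd; have x0 : x != 0 by apply: contra_eq_neq Dx => ->; rewrite val0.
have e_gt : val_gt 0 (d / x).
  have := valuationM hv x (d / x); rewrite mulrC divfK //.
  move: wd; rewrite /val_gt Dx; case: (v d) => [a|]; case: (v (d / x)) => [b|] //=.
  by move=> lt_wa [Da]; move: lt_wa; rewrite Da -{1}[w]add0r [w + b]addrC (og_ltD2r hG).
have val_e : v (1 + d / x) = Some 0 := val_ultra val1 e_gt.
have -> : x + d = (1 + d / x) * x by rewrite mulrDl mul1r divfK.
have O1 : 1 \in valuation_ring v by rewrite inE le_oo_val /val_ge val1.
have Oe : d / x \in valuation_ring v by rewrite inE le_oo_val val_gtW.
rewrite (acM hac) //; last by apply: contra_eq_neq val_e => ->; rewrite val0.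
rewrite (ac_unit hac) // (residueD hres) // (residue1 hres).
by rewrite ((residue_ker hres Oe).2 _) ?addr0 ?mul1r // lt_oo_val.
Qed.

(** The induction follows Horner's scheme: passing from p to pX + c turns the remainder q into p'(y)
    + q(y + h), which stays integral. *)
Lemma integral_taylor (p : {poly K}) y h :
    (forall i, val_ge 0 p`_i) -> val_ge 0 y -> val_ge 0 h ->
  val_ge 0 p.[y] /\ val_ge 0 p^`().[y] /\
  exists2 q, val_ge 0 q & p.[y + h] = p.[y] + p^`().[y] * h + h ^+ 2 * q.
Proof.
move=> + y0 h0; elim/poly_ind: p => [|p c IHp] coef_p.
  rewrite deriv0 !horner0 val_ge0r; do 2?split=> //.
  by exists 0; rewrite ?val_ge0r // !mul0r mulr0 !addr0.
have [|py [p'y [q q0 Dq]]] := IHp.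
  by move=> i; have := coef_p i.+1; rewrite coefD coefMX coefC addr0.
have c0 : val_ge 0 c by have := coef_p 0; rewrite coefD coefMX coefC add0r.
rewrite derivMXaddC hornerD hornerMX !hornerMXaddC; split.
  by rewrite val_geD ?val_ge0M.
split; first by rewrite val_geD ?val_ge0M.
exists (p^`().[y] + q * (y + h)); first by rewrite val_geD ?val_ge0M ?val_geD.
by rewrite Dq; ring.
Qed.

Lemma integral_deriv (p : {poly K}) :
  (forall i, val_ge 0 p`_i) -> forall i, val_ge 0 p^`()`_i.
Proof.
move=> coef_p i; rewrite coef_deriv; have := coef_p i.+1.
move: p`_i.+1 => c c0; elim: i.+1 => [|j IHj].
  by rewrite mulr0n val_ge0r.
by rewrite mulrS val_geD.
Qed.

(** For z = y - p(y)/p'(y) the constant and linear terms of the Taylor expansion cancel, and the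
    quadratic one has value at least 2w, while w > 0. *)
Lemma newton_step (p : {poly K}) x y w :
    (forall i, val_ge 0 p`_i) -> val_ge 0 x -> v p^`().[x] = Some 0 ->
    val_gt 0 p.[x] -> val_gt 0 (y - x) -> v p.[y] = Some w ->
  exists2 z, val_gt 0 (z - x) & val_gt w p.[z].
Proof.
move=> coef_p x0 p'x px yx py.
have y0 : val_ge 0 y by rewrite -[y](subrK x); apply: val_geD (val_gtW yx) x0.
(* Integral polynomials preserve congruence modulo the maximal ideal; this serves for both [p] and
   its derivative. *)
have shift (f : {poly K}) : (forall i, val_ge 0 f`_i) -> val_gt 0 (f.[y] - f.[x]).
  move=> coef_f; have [fx [f'x [q q0]]] := integral_taylor coef_f x0 (val_gtW yx).
  rewrite [x + _]addrC subrK => ->.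
  rewrite [X in val_gt _ X](_ : _ = (y - x) * (f^`().[x] + (y - x) * q)); last by ring.
  by rewrite -[0]addr0; apply/(val_gtM yx)/(val_geD f'x)/val_ge0M; first exact: val_gtW.
have p'y : v p^`().[y] = Some 0.
  rewrite -[X in v X](subrK p^`().[x]) addrC; apply: (val_ultra p'x).
  exact: shift (integral_deriv coef_p).
have p'y0 : p^`().[y] != 0 by apply: contra_eq_neq p'y => ->; rewrite val0.
have w0 : 0 < w.
  have : val_gt 0 (p.[y] - p.[x] + p.[x]) by rewrite val_gtD ?shift.
  by rewrite subrK /val_gt py.
pose h := - (p.[y] / p^`().[y]).
have Dh : v h = Some w by rewrite valN (valuationM hv) py val_unitV //= addr0.
have h_gt : val_gt 0 h by rewrite /val_gt Dh.
have [_ [_ [q q0 Dq]]] := integral_taylor coef_p y0 (val_gtW h_gt).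
exists (y + h); first by rewrite addrAC val_gtD.
have -> : p.[y + h] = h * q * h.
  have p'h : p^`().[y] * h = - p.[y] by rewrite /h mulrN mulrC divfK.
  by rewrite Dq p'h; ring.
rewrite -[w]add0r; apply: val_gtM; last by rewrite /val_ge Dh.
by rewrite -[0]addr0 val_gtM.
Qed.

(** The points [y] need not converge: they only stay in the open unit ball around [x] while the
    value of [g] grows. *)
Definition approximate_root (g : {poly K}) x : Prop :=
  forall c : G, exists2 y, val_gt 0 (y - x) & val_ge c g.[y].

(** If v(g) stays below c and v(h) below d on the ball, then v(gh) stays below c + d. *)
Lemma approximate_rootM (g h : {poly K}) x :
  approximate_root (g * h) x -> approximate_root g x \/ approximate_root h x.
Proof.
move=> gh; apply: NNPP => /not_or_and[ng nh].
have bound f : ~ approximate_root f x ->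
    exists c, forall y, val_gt 0 (y - x) -> ~ val_ge c f.[y].
  by move=> /not_all_ex_not[c nc]; exists c => y yx cy; apply: nc; exists y.
have [[c gc] [d hd]] := (bound g ng, bound h nh).
have [y yx] := gh (c + d).
have := gc y yx; have := hd y yx; rewrite /val_ge hornerM (valuationM hv).
case: (v g.[y]) => [a|] //; case: (v h.[y]) => [b|] //= /negP.
rewrite (og_leNgt hG) negbK => lt_bd /negP; rewrite (og_leNgt hG) negbK => lt_ac.
by rewrite /= (og_leNgt hG) (og_ltD hG) // ltW.
Qed.

(** Factoring repeatedly, some factor keeps the approximate root. A constant has none, and a linear
    polynomial would have its true root in the ball, which is excluded. *)
Lemma irreducible_approximate_root (g : {poly K}) x :
    g != 0 -> (exists c : G, 0 < c) ->
    approximate_root g x -> (forall y, root g y -> ~ val_gt 0 (y - x)) ->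
  exists h, [/\ irreducible_poly h, (2 < size h)%N & approximate_root h x].
Proof.
move=> g0 [c0 c0_gt].
have [n] := ubnP (size g); elim: n g g0 => // n IHn g g0.
rewrite ltnS => le_gn app noroot.
case: (leqP (size g) 1) => [/size1_polyC Dg|g_gt1].
  have [w Dw] : exists w, v g`_0 = Some w.
    by apply: val_some; rewrite Dg polyC_eq0 in g0.
  have [y _] := app (w + c0); rewrite Dg hornerC /val_ge Dw (og_leNgt hG).
  by rewrite -{1}[w]addr0 ![w + _]addrC (og_ltD2r hG) c0_gt.
have [irr_g|[q [r [Dg /andP[q_gt1 lt_q] /andP[r_gt1 lt_r]]]]] :=
  irreducible_or_factors g_gt1.
  exists g; split=> //; rewrite ltn_neqAle g_gt1 andbT eq_sym.
  apply/eqP=> size_g.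
  have g1 : g`_1 != 0 by rewrite -lead_coef_eq0 lead_coefE size_g in g0.
  have [w Dw] := val_some g1.
  have Hg y : g.[y] = g`_1 * (y + g`_0 / g`_1).
    rewrite horner_coef size_g big_ord_recr big_ord1 /= expr0 mulr1 expr1 mulrDr.
    by rewrite mulrCA mulfV // mulr1 addrC.
  apply: (noroot (- (g`_0 / g`_1))).
    by rewrite /root Hg addNr mulr0.
  (* The surplus [c0] makes the value of y + g_0/g_1 positive, so that the root is congruent to [y],
     hence to [x]. *)
  have [y yx] := app (w + c0); rewrite Hg /val_ge (valuationM hv) Dw => ge_c.
  have ry : val_gt 0 (y + g`_0 / g`_1).
    rewrite /val_gt; move: ge_c; case: (v (y + _)) => //= b.
    by rewrite ![w + _]addrC (og_leD2r hG); apply: lt_le_trans.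
  rewrite [_ - _](_ : _ = (y - x) - (y + g`_0 / g`_1)); last by ring.
  by rewrite val_gtD ?val_gtN.
have := app; rewrite Dg => /approximate_rootM[app_q|app_r].
  apply: (IHn q) => // [||y qy]; first by rewrite -size_poly_gt0 ltnW.
    exact: leq_trans le_gn.
  by apply: noroot; rewrite Dg rootM qy.
apply: (IHn r) => // [||y ry]; first by rewrite -size_poly_gt0 ltnW.
  exact: leq_trans le_gn.
by apply: noroot; rewrite Dg rootM ry orbT.
Qed.

(** * Local constancy of definable properties *)

(** This is continuity at 0: q(d) - q(0) = d r(d), with [r] bounded on the valuation ring. *)
Lemma val_ge_sum_factor (q : {poly K}) w : (exists c : G, 0 < c) ->
  exists2 B : G, 0 <= B & forall d, val_ge B d -> val_gt w (q.[d] - q.[0]).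
Proof.
move=> [c c0].
have /factor_theorem[r Dr] : root (q - q.[0]%:P) 0.
  by rewrite /root !hornerE subrr.
have [g rg] := horner_bounded r.
(* [B] is at least 0 to make [d] integral, and at least [w - g + c] to give d r(d) a value of at
   least [w + c]. *)
have [B [B0 Bw]] := og_upper_bound hG 0 (w - g + c).
exists B => // d Bd; have -> : q.[d] - q.[0] = d * r.[d].
  by have := congr1 (horner^~ d) Dr; rewrite /= !hornerE /= ?subr0 mulrC.
have := val_geM Bd (rg d (val_ge_trans B0 Bd)); apply: val_gt_trans.
apply: (@lt_le_trans _ _ (w - g + c + g)); last by rewrite (og_leD2r hG).
by rewrite addrAC subrK -{1}[w]addr0 ![w + _]addrC (og_ltD2r hG).
Qed.

Section Formulas.
Variables (one : G) (res ac : K -> k).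
Hypothesis one_gt0 : 0 < one.
Hypothesis hres : is_residue_map v res.
Hypothesis hac : is_angular_component v res ac.
Let S := rrp_structure_of v one ac.

(** This is all that a formula without field quantifiers sees of a term; even its vanishing is read
    off from [v]. *)
Definition same_data a (e e' : 'I_a -> K) (t : kterm a) : Prop :=
  v (kterm_eval e t) = v (kterm_eval e' t) /\
  ac (kterm_eval e t) = ac (kterm_eval e' t).

(** Near a nonzero value, [v] and [ac] are constant by continuity; a zero value is stable because
    the second hypothesis makes it zero along the whole line. *)
Lemma same_data_line (n : nat) (e : K -> 'I_n -> K) (t : kterm n) :
    (exists q : {poly K}, forall d, kterm_eval (e d) t = q.[d]) ->
    (kterm_eval (e 0) t = 0 -> forall d, kterm_eval (e d) t = 0) ->
  exists2 B : G, 0 <= B & forall d, val_ge B d -> same_data (e d) (e 0) t.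
Proof.
move=> [q Dq] t_zero; have [t0|/val_some[w Dw]] := eqVneq (kterm_eval (e 0) t) 0.
  by exists 0 => // d _; rewrite /same_data t0 t_zero.
have [|B B0 HB] := @val_ge_sum_factor q w; first by exists one.
exists B => // d /HB gt_w; rewrite -!Dq in gt_w.
rewrite /same_data -[kterm_eval (e d) t](subrK (kterm_eval (e 0) t)) addrC.
by rewrite (val_ultra Dw gt_w) (ac_ultra hres hac Dw gt_w).
Qed.

(** An equation between field terms says that their difference has infinite value, whence the [KSub]
    in [formula_kterms]. Quantifiers over the other sorts leave the field terms untouched. *)
Lemma sat_same_data a b c (f : formula a b c) (ek ek' : a.-tuple K) er eg :
    Kquantifier_free f ->
    (forall t, List.In t (formula_kterms f) -> same_data (tnth ek) (tnth ek') t) ->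
  sat (M := S) ek er eg f <-> sat (M := S) ek' er eg f.
Proof.
have rE a' b' (e e' : a'.-tuple K) (er' : b'.-tuple k) (t : rterm a' b') :
    (forall t', List.In t' (rterm_kterms t) -> same_data (tnth e) (tnth e') t') ->
    reval (M := S) e er' t = reval (M := S) e' er' t.
  elim: t => //= [t1 IH1 t2 IH2|t1 IH1 t2 IH2|t1 IH1 t2 IH2|t] ht; last first.
    by rewrite !keval_kterm_eval; have [] := ht t (or_introl erefl).
  - by rewrite IH1 ?IH2 // => t' tt'; apply: ht; [apply: In_catr | apply: In_catl].
  - by rewrite IH1 ?IH2 // => t' tt'; apply: ht; [apply: In_catr | apply: In_catl].
  - by rewrite IH1 ?IH2 // => t' tt'; apply: ht; [apply: In_catr | apply: In_catl].
have gE a' c' (e e' : a'.-tuple K) (eg' : c'.-tuple (option G)) (t : gterm a' c') :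
    (forall t', List.In t' (gterm_kterms t) -> same_data (tnth e) (tnth e') t') ->
    geval (M := S) e eg' t = geval (M := S) e' eg' t.
  elim: t => //= [t1 IH1 t2 IH2|t] ht; last first.
    by rewrite !keval_kterm_eval; have [] := ht t (or_introl erefl).
  by rewrite IH1 ?IH2 // => t' tt'; apply: ht; [apply: In_catr | apply: In_catl].
elim: f ek ek' er eg => {a b c} a b c.
- move=> t1 t2 ek ek' er eg _ /(_ _ (or_introl erefl))[same_v _] /=.
  rewrite !keval_kterm_eval; move: same_v => /= same_v.
  have zero e : kterm_eval (tnth e) t1 = kterm_eval (tnth e) t2 <->
      v (kterm_eval (tnth e) t1 - kterm_eval (tnth e) t2) = None.
    rewrite (valuation_eq_oo hv).
    by split=> [->|/eqP]; [rewrite subrr | rewrite subr_eq0 => /eqP].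
  by rewrite !zero same_v.
- move=> t1 t2 ek ek' er eg _ /= ht.
  rewrite (rE _ _ ek ek' er t1) ?(rE _ _ ek ek' er t2) // => t' tt'; apply: ht;
    [exact: In_catr | exact: In_catl].
- move=> t1 t2 ek ek' er eg _ /= ht.
  rewrite (gE _ _ ek ek' eg t1) ?(gE _ _ ek ek' eg t2) // => t' tt'; apply: ht;
    [exact: In_catr | exact: In_catl].
- move=> t1 t2 ek ek' er eg _ /= ht.
  rewrite (gE _ _ ek ek' eg t1) ?(gE _ _ ek ek' eg t2) // => t' tt'; apply: ht;
    [exact: In_catr | exact: In_catl].
- by move=> m m1 t ek ek' er eg _ /= ht; rewrite (gE _ _ ek ek' eg t).
- by move=> f IH ek ek' er eg /= qf ht; rewrite (IH ek ek').
- move=> f1 IH1 f2 IH2 ek ek' er eg /= /andP[qf1 qf2] ht.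
  rewrite (IH1 ek ek') ?(IH2 ek ek') // => t ft; apply: ht;
    [exact: In_catr | exact: In_catl].
- move=> f1 IH1 f2 IH2 ek ek' er eg /= /andP[qf1 qf2] ht.
  rewrite (IH1 ek ek') ?(IH2 ek ek') // => t ft; apply: ht;
    [exact: In_catr | exact: In_catl].
- move=> f1 IH1 f2 IH2 ek ek' er eg /= /andP[qf1 qf2] ht.
  rewrite (IH1 ek ek') ?(IH2 ek ek') // => t ft; apply: ht;
    [exact: In_catr | exact: In_catl].
- by [].
- by [].
- move=> f IH ek ek' er eg /= qf ht.
  have E y := IH ek ek' [tuple of y :: er] eg qf ht.
  by split=> -[y /E fy]; exists y.
- move=> f IH ek ek' er eg /= qf ht.
  have E y := IH ek ek' [tuple of y :: er] eg qf ht.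
  by split=> fy y; apply/E.
- move=> f IH ek ek' er eg /= qf ht.
  have E y := IH ek ek' er [tuple of y :: eg] qf ht.
  by split=> -[y /E fy]; exists y.
- move=> f IH ek ek' er eg /= qf ht.
  have E y := IH ek ek' er [tuple of y :: eg] qf ht.
  by split=> fy y; apply/E.
Qed.

Definition kterm_horner a (cs : seq (kterm a)) (y : kterm a) : kterm a :=
  foldr (fun c t => KAdd (KMul t y) c) (KZero a) cs.

Lemma keval_horner a (ek : a.-tuple K) cs y :
  keval (M := S) ek (kterm_horner cs y) =
  (Poly [seq keval (M := S) ek t | t <- cs]).[keval (M := S) ek y].
Proof. by rewrite horner_Poly; elim: cs => //= c cs ->. Qed.

Definition root_formula n : formula n 0 0 :=
  KEx (KEq _ _ (kterm_horner
              (rcons [seq KVar (lift ord0 i) | i <- enum 'I_n] (KOne _))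
              (KVar ord0)) (KZero _)).

Lemma sat_root_formula n (ek : n.-tuple K) er eg :
  sat (M := S) ek er eg (root_formula n) <-> exists y, root (Poly (rcons ek 1)) y.
Proof.
have E y : [seq keval (M := S) [tuple of y :: ek] t |
    t <- rcons [seq KVar (lift ord0 i) | i <- enum 'I_n] (KOne _)] = rcons ek 1.
  rewrite map_rcons -map_comp -[in RHS](map_tnth_enum ek); congr rcons.
  by apply: eq_map => i /=; rewrite tnthS.
split=> -[y].
  by rewrite keval_horner E /= tnth0 => /eqP; exists y.
by move=> /eqP ry; exists y; rewrite /= keval_horner E /= tnth0.
Qed.

(** Under the binder, field variable 0 is y, variable 1 is the center x, and the rest are
    coefficients of p; the value variable is the c of v(p(y)) >= c. *)
Definition approximation_formula n : formula n.+1 0 1 :=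
  KEx (FAnd
    (GLt _ (GZero _ _) (GVal _ (KSub (KVar ord0) (KVar (lift ord0 ord0)))))
    (FNot (GLt _ (GVal _ (kterm_horner
                 [seq KVar (lift ord0 (lift ord0 i)) | i <- enum 'I_n]
                 (KVar ord0)))
               (GVar _ ord0)))).

Lemma sat_approximation_formula n (ek : n.-tuple K) x er c :
  sat (M := S) [tuple of x :: ek] er [tuple Some c] (approximation_formula n) <->
  exists2 y, val_gt 0 (y - x) & val_ge c (Poly ek).[y].
Proof.
have E y : [seq keval (M := S) [tuple of y :: [tuple of x :: ek]] t |
    t <- [seq KVar (lift ord0 (lift ord0 i)) | i <- enum 'I_n]] = ek.
  by rewrite -map_comp -[RHS](map_tnth_enum ek); apply: eq_map => i /=; rewrite !tnthS.
split=> [[y]|[y yx yc]].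
  rewrite /= keval_horner E /= tnthS !tnth0 => -[yx /negP].
  by rewrite -val_geNlt => yc; exists y.
exists y; rewrite /= keval_horner E /= tnthS !tnth0; split=> //.
by apply/negP; rewrite -val_geNlt.
Qed.

End Formulas.
End Valuation.

(** At a generic [u], a term of [T] that vanishes at the coefficients of chi_u vanishes identically,
    as [same_data_line] requires. Finitely many terms have a common bound [B]. *)
Lemma perturbation_same_data (K k : fieldType) (G : porderZmodType) (one : G)
    (v : K -> option G) (res ac : K -> k) n (C : 'M[K]_n.+2) (T : seq (kterm n.+2)) :
    [pchar K] =i pred0 -> ordered_abelian_group G -> 0 < one ->
    is_valuation v -> is_residue_map v res -> is_angular_component v res ac ->
    irreducible_poly (char_poly C) ->
  exists u : 'rV[K]_n.+2, u 0 1 != 0 /\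
    exists2 B : G, 0 <= B & forall d, val_ge v B d -> forall t, List.In t T ->
    same_data v ac (fun i : 'I_n.+2 => (mx_char_poly C u - d%:P)`_i)
                   (fun i : 'I_n.+2 => (mx_char_poly C u)`_i) t.
Proof.
move=> charK hG one_gt0 hv hres hac irr_g.
have [u [u1 Tu]] := char_kterms_neq0 T charK irr_g.
exists u; split=> //; set chi := mx_char_poly C u in Tu *.
have bound t : List.In t T -> exists2 B : G, 0 <= B & forall d, val_ge v B d ->
    same_data v ac (fun i : 'I_n.+2 => (chi - d%:P)`_i) (fun i : 'I_n.+2 => chi`_i) t.
  move=> tT; pose e (d : K) (i : 'I_n.+2) := (chi - d%:P)`_i.
  have e0 : e 0 =1 (fun i : 'I_n.+2 => chi`_i) by move=> i; rewrite /e subr0.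
  have [||B B0 HB] := @same_data_line _ _ _ _ hG hv one res ac one_gt0 hres hac _ e t.
  (* Over K[X], the indeterminate is subtracted from the constant coefficient only. *)
  - exists (kterm_eval (fun i : 'I_n.+2 => (chi`_i)%:P - (i == 0)%:R *: 'X) t) => d.
    rewrite -[RHS]/(horner_eval d _) rmorph_kterm_eval.
    apply: eq_kterm_eval => i; rewrite /e /= /horner_eval coefB coefC !hornerE.
    by case: ifP => i0; rewrite -val_eqE /= i0 ?mul1r ?mul0r.
  - rewrite (eq_kterm_eval _ e0) => t0 d; apply/eqP; apply: contraT => td.
    by have := Tu t tT _ td; rewrite /char_kterm -/chi t0 eqxx.
  exists B => // d /HB[]; rewrite (eq_kterm_eval _ e0).
  by split.
elim: {Tu} T bound => [|t T IHT] bound; first by exists 0.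
have [|B B0 HB] := IHT; first by move=> t' t'T; apply: bound; right.
have [|B' B'0 HB'] := bound t; first by left.
have [D [DB DB']] := og_upper_bound hG B B'.
exists D => [|d Dd t' [<-|t'T]]; first exact: le_trans DB.
  exact: HB' (val_ge_trans DB' Dd).
exact: HB (val_ge_trans DB Dd) _ t'T.
Qed.

(** * From quantifier elimination to henselianity *)

Theorem theorem5p1 (K k : fieldType) (G : porderZmodType) (one : G)
    (v : K -> option G) (res ac : K -> k)
    (charK : [pchar K] =i pred0) (chark : [pchar k] =i pred0)
    (hG : Zgroup one)
    (hv : is_valuation v)
    (hres : is_residue_map v res)
    (hac : is_angular_component v res ac)
    (hqe : admits_Kquantifier_elimination (Th (rrp_structure_of v one ac))) :
  henselian v.
Proof.
have [oG [one_gt0 _] _] := hG.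
pose S := rrp_structure_of v one ac.
have qe a b c (f : formula a b c) : exists2 g : formula a b c, Kquantifier_free g &
    forall ek er eg, sat (M := S) ek er eg f <-> sat (M := S) ek er eg g.
  by have [g qf_g fg] := hqe a b c f; exists g => // ek er eg; apply: fg.
move=> p x pO; rewrite inE le_oo_val lt_oo_val => x0 px p'x.
have coef_p i : val_ge v 0 p`_i.
  have [lt_i|le_i] := ltnP i (size p); last by rewrite nth_default ?val_ge0r.
  by rewrite -le_oo_val; apply: (allP pO _ (mem_nth 0 lt_i)).
apply: NNPP => noroot.
have int_near y : val_gt v 0 (y - x) -> val_ge v 0 y.
  by move=> yx; rewrite -[y](subrK x) (val_geD hv) // val_gtW.
have {}noroot y : root p y -> ~ val_gt v 0 (y - x).
  move=> py yx; apply: noroot; exists y.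
  by rewrite inE le_oo_val lt_oo_val; split=> //; apply: int_near.
(* Were the values of [p] on the ball bounded, the set [D] of elements below them would have a
   maximum by [Kqf_has_max], and a Newton step would exceed it. *)
have app_p : approximate_root v p x.
  have [psi qf_psi psiE] := qe _ _ _ (approximation_formula (size p)).
  pose ek : (size p).-tuple K := in_tuple p.
  pose D (c : G) := exists2 y, val_gt v 0 (y - x) & val_ge v c p.[y].
  have DE c : sat (M := S) [tuple of x :: ek] [tuple] [tuple Some c] psi <-> D c.
    by rewrite -psiE sat_approximation_formula //= polyseqK.
  move=> c; apply: NNPP => nDc.
  have := @Kqf_has_max K k G one v ac _ _ [tuple of x :: ek] [tuple] psi hG qf_psi.
  case; first split.
  - by exists 0; apply/DE; exists x; rewrite ?subrr ?val_gt0r // val_gtW.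
  - exists c => b /DE[y yx by_] /= lt_cb; apply: nDc; exists y => //.
    exact: val_ge_trans (ltW lt_cb) by_.
  move=> b [/DE[y yx yb] b_max].
  case Dw: (v p.[y]) => [w|]; last first.
    by apply: (noroot y) => //; apply/eqP/(valuation_eq_oo hv).
  have [z zx zw] := newton_step oG hv coef_p x0 p'x px yx Dw.
  case Dw': (v p.[z]) => [w'|]; last first.
    by apply: (noroot z) => //; apply/eqP/(valuation_eq_oo hv).
  apply: (b_max w'); first by apply/DE; exists z; rewrite // /val_ge Dw'.
  move: zw yb; rewrite /val_gt /val_ge Dw Dw' /= => lt_ww' le_bw.
  exact: le_lt_trans lt_ww'.
have p0 : p != 0.
  apply: contraTneq (val_gt0r hv 0) => p0; rewrite -(subrr x); apply/negP.
  by apply: noroot; rewrite p0 root0.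
have [|h [irr_h size_h app_h]] := irreducible_approximate_root oG hv p0 _ app_p noroot.
  by exists one.
pose g := (lead_coef h)^-1 *: h.
have h0 : h != 0 by apply: irredp_neq0.
have lead_h : (lead_coef h)^-1 != 0 by rewrite invr_eq0 lead_coef_eq0.
have g_h : g %= h by rewrite eqp_scale.
have irr_g : irreducible_poly g.
  split; first by rewrite (eqp_size g_h) ltnW.
  move=> q q1; rewrite (eqp_dvdr _ g_h) => qh.
  by rewrite (eqp_trans (irr_h.2 q q1 qh)) // eqp_sym.
have monic_g : g \is monic.
  by rewrite monicE lead_coefZ mulVf // lead_coef_eq0.
(* Degree at least 2 provides the coordinate of index 1, which tells [u] from a scalar. *)
have [n size_g] : exists n, size g = n.+3.
  rewrite (eqp_size g_h); case: (size h) size_h => [|[|[|n]]] // _.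
  by exists n.
have [C charC] := char_poly_exists monic_g size_g.
have [psi qf_psi psiE] := qe _ _ _ (root_formula n.+2).
rewrite -charC in irr_g.
have [u [u1 [B B0 HB]]] := perturbation_same_data (formula_kterms psi) charK oG
  one_gt0 hv hres hac irr_g.
set chi := mx_char_poly C u in HB.
pose ek d := [tuple (chi - d%:P)`_i | i < n.+2].
have size_chi : size chi = n.+3 by rewrite size_char_poly.
have monic_chi d : Poly (rcons (ek d) 1) = chi - d%:P.
  have chi_lead : (chi - d%:P)`_n.+2 = 1.
    rewrite coefB coefC subr0 -[LHS]/chi`_n.+3.-1 -size_chi.
    exact: (monicP (char_poly_monic _)).
  apply/polyP=> i; rewrite coef_Poly nth_rcons size_tuple.
  case: (ltngtP i n.+2) => [lt_i|gt_i|->] //.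
    by rewrite -[i]/(val (Ordinal lt_i)) -tnth_nth tnth_mktuple.
  by rewrite coefB coefC nth_default ?size_chi //; case: i gt_i => // i; rewrite subr0.
(* Since chi(u(X)) = s g, a point [y] where [g] is small makes chi small at u(y). *)
have /dvdpP[s Ds] := dvdp_mx_char_poly_comp u irr_g.
rewrite -/chi charC in Ds.
have [c sc] := horner_bounded oG hv ((lead_coef h)^-1 *: s).
(* The cofactor has value at least [c] on the valuation ring, so [B - c] for [h] yields [B] for
   chi(u(y)). *)
have [y yx hy] := app_h (B - c).
have Bd : val_ge v B chi.[(rVpoly u).[y]].
  have -> : chi.[(rVpoly u).[y]] = h.[y] * ((lead_coef h)^-1 *: s).[y].
    by rewrite -horner_comp Ds hornerM !hornerZ mulrC mulrCA mulrA.
  rewrite -[B](subrK c).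
  exact: (val_geM oG hv hy (sc y (int_near y yx))).
set d := chi.[_] in Bd.
have ekE e (t : kterm n.+2) :
    kterm_eval (tnth (ek e)) t = kterm_eval (fun i : 'I_n.+2 => (chi - e%:P)`_i) t.
  by apply: eq_kterm_eval => i; rewrite tnth_mktuple.
have same : sat (M := S) (ek d) [tuple] [tuple] psi <->
    sat (M := S) (ek 0) [tuple] [tuple] psi.
  apply: (sat_same_data hv) => // t tpsi; have := HB d Bd t tpsi.
  by rewrite /same_data !ekE subr0.
(* The polynomial chi - d has the root u(y); by local constancy chi then has a root as well. *)
have : sat (M := S) (ek 0) [tuple] [tuple] (root_formula n.+2).
  apply/psiE/same/psiE/sat_root_formula; exists (rVpoly u).[y].
  by rewrite monic_chi /root !hornerE subrr.
move=> /sat_root_formula[z]; rewrite monic_chi subr0; apply/negP.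
exact: mx_char_poly_rootN.
Qed.
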